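(* Let $\alpha\in[0,1)$ and let $G$ be a connected graph of order $n\ge 4$ with $G\not\cong P_n$. Then $\mu_{\alpha}(G)\le\mu_{\alpha}(B_{n,3})<\mu_{\alpha}(P_n)$, and equality $\mu_{\alpha}(G)=\mu_{\alpha}(B_{n,3})$ holds if and only if $G\cong B_{n,3}$.
   Context: All graphs are finite, simple and undirected; $P_m$ is the path on $m$ vertices. $B_{n,3}$ is the tree of order $n$ obtained by attaching $2$ pendant vertices to a terminal vertex of the path $P_{n-2}$. For a connected graph $G$ with distance function $d_G$, the transmission of a vertex $u$ is $T_G(u)=\sum_{v\in V(G)}d_G(u,v)$, $T(G)$ is the diagonal matrix of transmissions and $D(G)=(d_G(u,v))_{u,v\in V(G)}$ the distance matrix. For $\alpha\in[0,1)$, $D_{\alpha}(G)=\alpha T(G)+(1-\alpha)D(G)$, and $\mu_{\alpha}(G)$ (the distance $\alpha$-spectral radius) is the largest eigenvalue of the symmetric matrix $D_{\alpha}(G)$. *)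

(* Defs.v *)
From mathcomp Require Import all_boot all_order all_algebra.
From mathcomp Require Import classical_sets reals.
From mathcomp Require Import spectral complex.

Set Implicit Arguments.
Unset Strict Implicit.
Unset Printing Implicit Defensive.

Import Order.TTheory GRing.Theory Num.Theory.
Local Open Scope ring_scope.

Record sgraph := SGraph {
  vertex :> finType;
  adj : rel vertex;
  adj_sym : symmetric adj;
  adj_irrefl : irreflexive adj }.

Definition connected_graph (G : sgraph) : Prop :=
  forall x y : G, connect (@adj G) x y.

Definition isomorphic (G H : sgraph) : Prop :=
  exists2 f : G -> H, bijective f & forall x y, adj (f x) (f y) = adj x y.

(* Least length of a walk from [x] to [y]. A shortest walk has fewer than
   [#|G|] edges, so the search is bounded; the value is [#|G|] if there is no
   walk from [x] to [y], see [gdist_walk] and [gdist_le]. *)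
Definition gdist (G : sgraph) (x y : G) : nat :=
  find (fun k => [exists p : k.-tuple G, path (@adj G) x p && (last x p == y)])
       (iota 0 #|G|).

Definition transmission (G : sgraph) (u : G) : nat :=
  (\sum_(v : G) gdist u v)%N.

Section DistanceMatrices.
Variable R : realType.

Definition transmission_mx (G : sgraph) : 'M[R]_#|G| :=
  diag_mx (\row_i (transmission (enum_val i))%:R).

Definition distance_mx (G : sgraph) : 'M[R]_#|G| :=
  \matrix_(i, j) (gdist (enum_val i) (enum_val j))%:R.

Definition Dalpha (alpha : R) (G : sgraph) : 'M[R]_#|G| :=
  alpha *: transmission_mx G + (1 - alpha) *: distance_mx G.

(* For a symmetric matrix of positive order this supremum is an eigenvalue,
   see [max_eigenvalue_sym]. *)
Definition max_eigenvalue n (A : 'M[R]_n) : R :=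
  sup [set a : R | eigenvalue A a]%classic.

Definition mu_alpha (alpha : R) (G : sgraph) : R :=
  max_eigenvalue (Dalpha alpha G).

End DistanceMatrices.

Definition path_adj n : rel 'I_n :=
  fun i j => ((i.+1 == j) || (j.+1 == i))%N.

Lemma path_adj_sym n : symmetric (@path_adj n).
Proof. by move=> i j; rewrite /path_adj orbC. Qed.

Lemma path_adj_irrefl n : irreflexive (@path_adj n).
Proof. by move=> i; rewrite /path_adj orbb eqn_leq ltnn. Qed.

Definition path_graph n : sgraph :=
  SGraph (@path_adj_sym n) (@path_adj_irrefl n).

(* [inl] injects the path on [n - 2] vertices, whose terminal vertex
   [n - 3] carries the two pendant vertices [inr _]. *)
Definition B3_adj n : rel ('I_(n - 2) + 'I_2)%type :=
  fun x y => match x, y with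
  | inl i, inl j => path_adj i j
  | inl i, inr _ | inr _, inl i => (i.+1 == n - 2)%N
  | inr _, inr _ => false
  end.

Lemma B3_adj_sym n : symmetric (@B3_adj n).
Proof. by move=> [i|i] [j|j] //=; rewrite path_adj_sym. Qed.

Lemma B3_adj_irrefl n : irreflexive (@B3_adj n).
Proof. by move=> [i|i] //=; rewrite path_adj_irrefl. Qed.

Definition B3_graph n : sgraph :=
  SGraph (@B3_adj_sym n) (@B3_adj_irrefl n).

Section GdistFacts.
Variable G : sgraph.
Implicit Types (x y : G) (p : seq G).

Lemma gdist_le x y p :
  path (@adj G) x p -> last x p = y -> (gdist x y <= size p)%N.
Proof.
move=> pp lp; have [le_Gp|lt_pG] := leqP #|G| (size p).
  by apply: leq_trans le_Gp; rewrite /gdist -[leqRHS](size_iota 0) find_size.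
rewrite leqNgt; apply/negP => /(before_find 0%N); rewrite nth_iota // add0n.
by case/existsP; exists (in_tuple p); rewrite /= pp lp /=.
Qed.

Lemma gdist_walk x y : connect (@adj G) x y ->
  exists p, [/\ path (@adj G) x p, last x p = y & size p = gdist x y].
Proof.
case/connectP=> p0 + ->; case/shortenP=> p pp up _.
have lt_pG : (size p < #|G|)%N by rewrite -[_.+1](card_uniqP up) max_card.
set y' := last x p.
have lt_dG : (gdist x y' < #|G|)%N by apply: leq_ltn_trans (gdist_le pp _) lt_pG.
have : has (fun k => [exists p : k.-tuple G,
    path (@adj G) x p && (last x p == y')]) (iota 0 #|G|).
  by rewrite has_find size_iota.
move=> /(nth_find 0%N); rewrite -/(gdist x y') nth_iota // add0n.
by case/existsP=> q /andP[qq /eqP lq]; exists q; rewrite size_tuple.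
Qed.

Lemma gdist_sym : connected_graph G -> forall x y, gdist x y = gdist y x.
Proof.
move=> cG.
suff le_d x y : (gdist x y <= gdist y x)%N.
  by move=> x y; apply/eqP; rewrite eqn_leq !le_d.
have [p [pp lp <-]] := gdist_walk (cG y x).
rewrite -(size_belast y p) -size_rev; apply: gdist_le.
  by rewrite -lp rev_path (eq_path (e' := @adj G)) // => u v; rewrite adj_sym.
by rewrite -lp; case: (p) => //= u q; rewrite rev_cons last_rcons.
Qed.

End GdistFacts.

Lemma card_path_graph n : #|path_graph n| = n.
Proof. exact: card_ord. Qed.

Lemma card_B3_graph n : (2 <= n)%N -> #|B3_graph n| = n.
Proof. by move=> ?; rewrite /= card_sum !card_ord subnK. Qed.

Section MaxEigenvalueFacts.
Variable R : realType.

Lemma max_eigenvalue_sym n (A : 'M[R]_n) : (0 < n)%N -> A^T = A ->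
  eigenvalue A (max_eigenvalue A) /\
  forall a, eigenvalue A a -> a <= max_eigenvalue A.
Proof.
case: n A => // n A _ symA.
pose B : 'M[R[i]]_n.+1 := map_mx (real_complex R) A.
have hB : B \is hermsymmx.
  apply: realsym_hermsym.
    by apply/is_hermitianmxP; rewrite expr0 scale1r map_mx_id // map_trmx symA.
  by apply/mxOverP => i j; rewrite mxE; apply/complex_realP; exists (A i j).
have /orthomx_spectralP eB := hermitian_normalmx hB.
set P := spectralmx B in eB; set d := spectral_diag B in eB.
have uP : P \in unitmx := spectral_unit B.
have rd j : {r | d 0 j = r%:C%C}.
  exists (complex.Re (d 0 j)).
  have /mxOverP/(_ 0 j)/RRe_real := hermitian_spectral_diag_real hB.
  by move->.
have mapE a : eigenvalue A a = eigenvalue B a%:C%C.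
  exact/esym/(eigenvalue_map (real_complex R)).
have eigd j : eigenvalue A (sval (rd j)).
  rewrite mapE -(svalP (rd j)); apply/eigenvalueP; exists (row j P).
    rewrite -row_mul eB mulmxA mulmxA mulmxV // mul1mx row_mul.
    by rewrite row_diag_mx -scalemxAl -rowE.
  apply/eqP => /(congr1 (mulmx^~ (invmx P))); rewrite rowE mulmxK // mul0mx.
  by move=> /matrixP/(_ 0 j)/eqP; rewrite !mxE !eqxx oner_eq0.
have eigP a : eigenvalue A a -> exists j, a = sval (rd j).
  rewrite mapE => /eigenvalueP[v]; rewrite eB !mulmxA => ev v0.
  have v'0 : v *m invmx P != 0.
    by apply: contraNneq v0 => e; rewrite -[v](mulmxKV uP) e mul0mx.
  have /rV0Pn[j vj] := v'0; exists j; apply: complexI.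
  rewrite -(svalP (rd j)); apply: (mulIf vj).
  have := congr1 (mulmx^~ (invmx P)) ev; rewrite mulmxK // -scalemxAl.
  by move=> /matrixP/(_ 0 j); rewrite mul_mx_diag !mxE mulrC => ->.
have [j0 _ maxj] := @arg_maxP _ _ _ (ord0 : 'I_n.+1) predT
  (fun j => sval (rd j)) isT.
have ubA a : eigenvalue A a -> a <= sval (rd j0).
  by move=> /eigP[j ->]; apply: maxj.
suff -> : max_eigenvalue A = sval (rd j0) by split.
apply/le_anti/andP; split.
  by apply: ge_sup => //; exists (sval (rd j0)); apply: eigd.
by apply: ub_le_sup; [exists (sval (rd j0)) | apply: eigd].
Qed.

Lemma Dalpha_sym (alpha : R) (G : sgraph) : connected_graph G ->
  (Dalpha alpha G)^T = Dalpha alpha G.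
Proof.
move=> cG; rewrite /Dalpha linearD !linearZ /= tr_diag_mx; congr (_ + _ *: _).
by apply/matrixP => i j; rewrite !mxE gdist_sym.
Qed.

Lemma mu_alpha_eigenvalue (alpha : R) (G : sgraph) :
  (0 < #|G|)%N -> connected_graph G ->
  eigenvalue (Dalpha alpha G) (mu_alpha alpha G) /\
  forall a, eigenvalue (Dalpha alpha G) a -> a <= mu_alpha alpha G.
Proof. by move=> G0 cG; apply/max_eigenvalue_sym/Dalpha_sym. Qed.

End MaxEigenvalueFacts.

(* Main.v *)
(* For [x > 0] the quadratic form of [D_alpha] is a sum [\sum w u v * d u
   v] with weights [w u v = alpha x_u^2 + (1 - alpha) x_u x_v > 0] on the
   ordered pairs, so by Rayleigh's principle and the Perron vector of [G] it
   is enough to relabel the vertices of [G] by those of [B_{n,3}] so that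
   this sum grows.

   If [G] has a vertex of degree at least 3, this is possible for arbitrary
   nonnegative weights. Start from a star [K_{1,3}] and add the vertices one
   at a time, a new vertex [h] next to a vertex [p] already there: moving
   the weight of [h] onto [p] reduces the claim to [B_{m,3}] with a pendant
   vertex [h] attached anywhere. Distances from a pendant vertex are convex
   in the point of attachment along a path, so the weighted sum is largest
   at one of the two ends of the path, and two such slides lead to
   [B_{m+1,3}]. The same convexity gives [mu (B_{n,3}) < mu (P_n)].
   Strictness comes from first lowering the weight of the edges of [G] a
   little: in the case of equality every edge of [G] then has to go to an
   edge of [B_{n,3}].

   If all degrees are at most 2, a longest path is Hamiltonian, so [G] is a
   path or a cycle, and for the cycle [mu <= max transmission <= n^2 / 4],
   which is less than the average transmission of [B_{n,3}]. *)

Require Import Defs.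
From mathcomp Require Import all_boot all_order all_algebra.
From mathcomp Require Import reals spectral complex zify ring lra.

Import Order.TTheory GRing.Theory Num.Theory.
Local Open Scope sesquilinear_scope.
Local Open Scope ring_scope.
Set Implicit Arguments.
Unset Strict Implicit.
Unset Printing Implicit Defensive.


(** * Rayleigh quotients and Perron vectors *)

Section Rayleigh.
Variable R : realType.

(** Diagonalise the complexified matrix by a unitary [P]: with [y = x P^-1] the two forms are the
    sums of [d_j |y_j|^2] and of [|y_j|^2], and each [d_j] is a real eigenvalue of [A]. *)
Lemma rayleigh_max_eigenvalue n (A : 'M[R]_n) (x : 'rV[R]_n) : A^T = A ->
  (x *m A *m x^T) 0 0 <= max_eigenvalue A * (x *m x^T) 0 0.
Proof.
case: n A x => [A x _|n A x symA].
  by rewrite !mxE !big_ord0 mulr0.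
have [_ ubA] := max_eigenvalue_sym (ltn0Sn n) symA.
set mu := max_eigenvalue A in ubA *.
pose f := real_complex R; pose B : 'M[R[i]]_n.+1 := map_mx f A.
have hB : B \is hermsymmx.
  apply: realsym_hermsym.
    by apply/is_hermitianmxP; rewrite expr0 scale1r map_mx_id // map_trmx symA.
  by apply/mxOverP => i j; rewrite mxE; apply/complex_realP; exists (A i j).
have /orthomx_spectralP := hermitian_normalmx hB.
set P := spectralmx B; set d := spectral_diag B => eB.
have uP : P \is unitarymx := spectral_unitarymx B.
have uPi := unitarymx_unit uP.
have le_d j : d 0 j <= f mu.
  have /mxOverP/(_ 0 j)/complex_realP[r er] := hermitian_spectral_diag_real hB.
  rewrite -/d in er; rewrite er lecR; apply: ubA.
  rewrite -(eigenvalue_map f); apply/eigenvalueP; exists (row j P).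
    rewrite -/B -row_mul eB mulmxA mulmxA mulmxV // mul1mx row_mul.
    by rewrite row_diag_mx -scalemxAl -rowE er.
  apply/eqP => /(congr1 (mulmx^~ (invmx P))); rewrite rowE mulmxK // mul0mx.
  by move=> /matrixP/(_ 0 j)/eqP; rewrite !mxE !eqxx oner_eq0.
pose X := map_mx f x; pose y := X *m invmx P.
have XE : X = y *m P by rewrite mulmxKV.
have XT : map_mx f x^T = X ^t*.
  apply/matrixP => i j; rewrite !mxE (CrealP _) //.
  by apply/complex_realP; exists (x j i).
have yT : P *m X ^t* = y ^t*.
  by rewrite /y invmx_unitary // trmx_mul map_mxM trmxCK.
have e1 : f ((x *m x^T) 0 0) = \sum_j `|y 0 j| ^+ 2.
  transitivity (map_mx f (x *m x^T) 0 0); first by rewrite [RHS]mxE.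
  rewrite map_mxM XT -/X {1}XE -mulmxA yT mxE; apply: eq_bigr => j _.
  by rewrite !mxE normCK.
have e2 : f ((x *m A *m x^T) 0 0) = \sum_j d 0 j * `|y 0 j| ^+ 2.
  transitivity (map_mx f (x *m A *m x^T) 0 0); first by rewrite [RHS]mxE.
  rewrite !map_mxM XT -/X -/B eB mulmxA mulmxA -/y -mulmxA yT mul_mx_diag mxE.
  by apply: eq_bigr => j _; rewrite !mxE normCK mulrA [d 0 j * _]mulrC.
rewrite -lecR; suff : f ((x *m A *m x^T) 0 0) <= f (mu * (x *m x^T) 0 0) by [].
rewrite {2}/f rmorphM /= -/f -/(f mu) -/(f ((x *m x^T) 0 0)) e1 e2 mulr_sumr.
apply: ler_sum => j _.
by rewrite ler_wpM2r // exprn_ge0.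
Qed.

Lemma eq0_of_quadratic_ge0 (a b : R) : 0 <= a -> 0 <= b ->
  (forall t, 0 <= t * a *+ 2 + t ^+ 2 * b) -> a = 0.
Proof.
(* The minimiser would be [- a / b]; using [b + 1] covers [b = 0] and still gives a negative value
   unless [a = 0]. *)
move=> a0 b0 /(_ (- (a / (b + 1)))).
have -> : - (a / (b + 1)) * a *+ 2 + (- (a / (b + 1))) ^+ 2 * b
   = - (a ^+ 2 * ((b + 2) / (b + 1) ^+ 2)).
  by field; lra.
rewrite oppr_ge0 pmulr_lle0; last by rewrite divr_gt0 ?exprn_gt0 //; lra.
by move=> h; apply/eqP; rewrite -sqrf_eq0 eq_le h sqr_ge0.
Qed.

(** [M = mu I - A] is positive semidefinite and its form vanishes at [x]. Moving [x] by [t v] with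
    [v = x M] changes the form to [2 t |v|^2 + t^2 v M v^T], which stays nonnegative for all [t]
    only if [v = 0]. *)
Lemma rayleigh_eq n (A : 'M[R]_n) (x : 'rV[R]_n) : A^T = A ->
  (x *m A *m x^T) 0 0 = max_eigenvalue A * (x *m x^T) 0 0 ->
  x *m A = max_eigenvalue A *: x.
Proof.
move=> symA; set mu := max_eigenvalue A => ex.
pose M : 'M[R]_n := mu%:M - A.
have symM : M^T = M by rewrite /M linearB /= tr_scalar_mx symA.
have psd (z : 'rV_n) : 0 <= (z *m M *m z^T) 0 0.
  rewrite /M mulmxBr mulmxBl mul_mx_scalar -scalemxAl.
  by have := rayleigh_max_eigenvalue z symA; rewrite -/mu !mxE subr_ge0.
have x0 : (x *m M *m x^T) 0 0 = 0.
  rewrite /M mulmxBr mulmxBl mul_mx_scalar -scalemxAl.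
  by move: ex; rewrite -/mu !mxE => ->; rewrite subrr.
pose v := x *m M.
suff v0 : v = 0.
  apply/eqP; rewrite eq_sym -subr_eq0 -mul_mx_scalar -mulmxBr.
  by rewrite -/M -/v v0 eqxx.
pose a := (v *m v^T) 0 0; pose b := (v *m M *m v^T) 0 0.
have aE : a = \sum_j v 0 j ^+ 2.
  by rewrite /a mxE; apply: eq_bigr => j _; rewrite [v^T _ _]mxE expr2.
have key t : 0 <= t * a *+ 2 + t ^+ 2 * b.
  have vx : v *m M *m x^T = v *m v^T.
    by rewrite -[in LHS]mulmxA -[in LHS]symM -trmx_mul.
  have vME : v *m M *m v^T = b%:M by rewrite [LHS]mx11_scalar.
  have vvE : v *m v^T = a%:M by rewrite [LHS]mx11_scalar.
  have xxE : v *m x^T = 0 by rewrite [LHS]mx11_scalar x0 raddf0.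
  have := psd (x + t *: v).
  rewrite [(_ + _)^T]linearD /= [(t *: v)^T]linearZ /= mulmxDl mulmxDr !mulmxDl.
  rewrite -!scalemxAl -!scalemxAr -/v vx vvE vME xxE !mxE eqxx.
  by rewrite !mulr1n; lra.
have a_ge0 : 0 <= a by rewrite aE sumr_ge0 // => j _; rewrite sqr_ge0.
have a0 := eq0_of_quadratic_ge0 a_ge0 (psd v) key.
apply/rowP => j; rewrite [RHS]mxE; apply/eqP; rewrite -sqrf_eq0.
move: a0; rewrite aE => /eqP; rewrite psumr_eq0 => [|i _]; last exact: sqr_ge0.
by move=> /allP/(_ j); rewrite mem_index_enum => /(_ isT).
Qed.

End Rayleigh.


(** * The graph distance as a metric *)

Section Gdist.
Variable G : sgraph.
Implicit Types x y z : G.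

Lemma gdistxx x : gdist x x = 0%N.
Proof. by apply/eqP; rewrite -leqn0; apply: (@gdist_le _ x x [::]). Qed.

Lemma gdist_adj_le x y : adj x y -> (gdist x y <= 1)%N.
Proof. by move=> axy; apply: (@gdist_le _ x y [:: y]); rewrite //= axy. Qed.

Hypothesis cG : connected_graph G.

Lemma gdist_triangle y x z : (gdist x z <= gdist x y + gdist y z)%N.
Proof.
have [p [pp lp <-]] := gdist_walk (cG x y).
have [q [qq lq <-]] := gdist_walk (cG y z).
rewrite -size_cat; apply: gdist_le; first by rewrite cat_path pp lp.
by rewrite last_cat lp.
Qed.

Lemma gdist_eq0 x y : (gdist x y == 0%N) = (x == y).
Proof.
apply/eqP/eqP => [d0|->]; last exact: gdistxx.
have [p [_ lp]] := gdist_walk (cG x y).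
by rewrite d0; case: p lp.
Qed.

Lemma gdist_eq1 x y : (gdist x y == 1%N) = adj x y.
Proof.
apply/eqP/idP => [d1|axy].
  have [p [pp lp]] := gdist_walk (cG x y).
  by rewrite d1; case: p pp lp => [|z [|]] //=; rewrite andbT => ? <-.
apply/eqP; rewrite eqn_leq gdist_adj_le //= lt0n gdist_eq0.
by apply: contraTneq axy => ->; rewrite adj_irrefl.
Qed.

Lemma gdist_lipschitz (f : G -> nat) x y :
  (forall u v, adj u v -> (f v <= (f u).+1)%N) -> (f y <= f x + gdist x y)%N.
Proof.
move=> lf; have [p [pp <- <-]] := gdist_walk (cG x y).
elim: p x pp => [|z p IHp] x /=; first by rewrite addn0.
case/andP=> /lf lz /IHp h; apply: leq_trans h _.
by rewrite addnS -addSn leq_add2r.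
Qed.

End Gdist.

Lemma gdist_homo (G H : sgraph) (f : G -> H) : connected_graph G ->
  (forall x y, adj x y -> adj (f x) (f y)) ->
  forall x y, (gdist (f x) (f y) <= gdist x y)%N.
Proof.
move=> cG hf x y; have [p [pp lp <-]] := gdist_walk (cG x y).
rewrite -(size_map f); apply: gdist_le; last by rewrite last_map lp.
by apply: homo_path pp.
Qed.

(** * The quadratic form of [D_alpha] and its Perron vector *)

Section Form.
Variables (R : realType) (alpha : R).

Definition pair_weight (V : finType) (x : V -> R) (u v : V) : R :=
  alpha * x u ^+ 2 + (1 - alpha) * (x u * x v).

(** The sum runs over ordered pairs, since [w] need not be symmetric; it is restricted to [S] so
    that vertices can be added one at a time. *)
Definition wsum (V : finType) (S : {set V}) (w : V -> V -> R)
    (d : V -> V -> nat) : R :=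
  \sum_(u in S) \sum_(v in S) w u v * (d u v)%:R.

Lemma Dalpha_form (G : sgraph) (x : G -> R) :
  let X := \row_i x (enum_val i) in
  (X *m Dalpha alpha G *m X^T) 0 0 = wsum setT (pair_weight x) (@gdist G).
Proof.
move=> X; rewrite /wsum -mulmxA mxE.
rewrite [RHS](reindex _ (onW_bij _ (enum_val_bij G))) /=.
apply: eq_big => [i|i _]; first by rewrite inE.
rewrite !mxE [in RHS](reindex _ (onW_bij _ (enum_val_bij G))) /=.
pose e (k : 'I_#|G|) : G := enum_val k.
transitivity (\sum_j (alpha * x (e i) ^+ 2 * (gdist (e i) (e j))%:R +
    (1 - alpha) * (x (e i) * x (e j)) * (gdist (e i) (e j))%:R)); last first.
  by apply: eq_big => [j|j _]; rewrite ?inE // -mulrDl.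
rewrite big_split /= -mulr_sumr.
transitivity (\sum_j
   (x (e i) * ((alpha * ((transmission (e i))%:R *+ (i == j))) * x (e j)) +
    (1 - alpha) * (x (e i) * x (e j)) * (gdist (e i) (e j))%:R)).
  rewrite mulr_sumr; apply: eq_bigr => j _.
  rewrite !mxE -/(e _) -/(e _) mulrDl mulrDr; congr (_ + _).
  by ring.
rewrite big_split /=; congr (_ + _).
rewrite (bigD1 i) //= eqxx mulr1n big1 ?addr0 => [|j ji]; last first.
  by rewrite eq_sym (negbTE ji) mulr0n; ring.
rewrite /transmission natr_sum.
rewrite [in LHS](reindex _ (onW_bij _ (enum_val_bij G))) /=.
by rewrite -/e; ring.
Qed.

Lemma sqr_sum_row (G : sgraph) (x : G -> R) :
  let X : 'rV_#|G| := \row_i x (enum_val i) in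
  (X *m X^T) 0 0 = \sum_u x u ^+ 2.
Proof.
move=> X; rewrite mxE [RHS](reindex _ (onW_bij _ (enum_val_bij G))) /=.
by apply: eq_bigr => i _; rewrite !mxE expr2.
Qed.

Lemma form_le_mu (G : sgraph) (x : G -> R) : connected_graph G ->
  wsum setT (pair_weight x) (@gdist G) <= mu_alpha alpha G * \sum_u x u ^+ 2.
Proof.
move=> cG; rewrite -Dalpha_form -sqr_sum_row.
exact/rayleigh_max_eigenvalue/Dalpha_sym.
Qed.

Hypothesis alpha01 : 0 <= alpha < 1.

Lemma ler_wsum (V : finType) (S : {set V}) (w w' : V -> V -> R)
    (d d' : V -> V -> nat) :
  {in S &, forall u v, w u v * (d u v)%:R <= w' u v * (d' u v)%:R} ->
  wsum S w d <= wsum S w' d'.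
Proof.
by move=> h; apply: ler_sum => u uS; apply: ler_sum => v vS; apply: h.
Qed.

(** Replacing an eigenvector for [mu] by its absolute values does not lower the form, so these
    attain the Rayleigh maximum and again form an eigenvector. *)
Lemma perron (G : sgraph) : (0 < #|G|)%N -> connected_graph G ->
  exists2 x : G -> R, (forall u, 0 < x u) &
    wsum setT (pair_weight x) (@gdist G) = mu_alpha alpha G * \sum_u x u ^+ 2.
Proof.
move=> G0 cG; case/andP: alpha01 => a0 a1.
have [/eigenvalueP[v ev v0] _] := mu_alpha_eigenvalue alpha G0 cG.
pose y u := v 0 (enum_rank u); pose x u := `|y u|.
pose X : 'rV_#|G| := \row_i x (enum_val i).
have vE : v = \row_i y (enum_val i).
  by apply/rowP => i; rewrite mxE /y enum_valK.
have form_y : wsum setT (pair_weight y) (@gdist G) =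
    mu_alpha alpha G * \sum_u y u ^+ 2.
  by rewrite -Dalpha_form -sqr_sum_row -vE ev -scalemxAl mxE.
have form_x : wsum setT (pair_weight x) (@gdist G) =
    mu_alpha alpha G * \sum_u x u ^+ 2.
  apply/le_anti/andP; split; first exact: form_le_mu.
  under eq_bigr => u _ do rewrite real_normK ?num_real //.
  rewrite -form_y; apply: ler_wsum => u w _ _; apply: ler_wpM2r => //.
  rewrite /pair_weight real_normK ?num_real // lerD2l.
  rewrite ler_wpM2l ?subr_ge0 ?(ltW a1) //.
  by rewrite -normrM ler_norm.
have eX : X *m Dalpha alpha G = mu_alpha alpha G *: X.
  apply: rayleigh_eq; first exact: Dalpha_sym.
  by rewrite Dalpha_form sqr_sum_row.
(* If [x u = 0], coordinate [u] of the eigenvalue equation is a vanishing sum of nonnegative terms.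
   For [t != u] the matrix entry [(1 - alpha) d(t, u)] is positive, so [x t = 0], and [v] would be
   zero. *)
exists x => // u; rewrite lt_def normr_ge0 andbT; apply/eqP => xu0.
case/eqP: v0; apply/rowP => j; rewrite [RHS]mxE; apply/eqP.
have -> : v 0 j = y (enum_val j) by rewrite /y enum_valK.
rewrite -normr_eq0 -/(x _); set t := enum_val j.
have [->|ut] := eqVneq t u; first exact/eqP.
have /eqP := congr1 (fun M : 'rV_#|G| => M 0 (enum_rank u)) eX.
rewrite mxE [X in _ == X]mxE [X 0 _]mxE enum_rankK xu0 mulr0.
have A_ge0 i k : 0 <= (Dalpha alpha G) i k.
  by rewrite !mxE addr_ge0 // mulr_ge0 ?subr_ge0 ?(ltW a1) ?mulrn_wge0.
have X_ge0 i : 0 <= X 0 i by rewrite mxE normr_ge0.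
rewrite psumr_eq0 => [|i _]; last exact: mulr_ge0.
move=> /allP/(_ (enum_rank t)); rewrite mem_index_enum => /(_ isT) /=.
rewrite mulf_eq0 [X 0 _]mxE enum_rankK => /orP[//|].
rewrite !mxE !enum_rankK (inj_eq enum_rank_inj) (negbTE ut) mulr0n mulr0 add0r.
rewrite mulf_eq0 subr_eq0 eq_sym (lt_eqF a1) /= pnatr_eq0 gdist_eq0 //.
by rewrite (negbTE ut).
Qed.

End Form.


(** * Relabelling graphs with a vertex of degree at least 3 *)

(* Distance of [B_{n,3}] with vertices numbered [0, ..., n-1]: the path is
   [0 - 1 - ... - n-2] and the last vertex [n-1] hangs from [n-3]. *)
Definition dB (n i j : nat) : nat :=
  if i == j then 0%N else
  (minn i (n - 2) - minn j (n - 2) + (minn j (n - 2) - minn i (n - 2)) +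
   (if (n - 2 <= i) && (n - 2 <= j) then 2 else 0))%N.

Lemma dBC n i j : dB n i j = dB n j i.
Proof. by rewrite /dB eq_sym andbC; case: eqP => // _; lia. Qed.

Lemma dBxx n i : dB n i i = 0%N.
Proof. by rewrite /dB eqxx. Qed.

Section Domination.
Variables (R : realType) (V : finType).
Implicit Types (S : {set V}) (s : V -> nat) (d : V -> V -> nat)
  (w : V -> V -> R).

(** By counting, [s] restricts to a bijection of [S] onto the labels [0, ..., #|S| - 1]; its values
    off [S] are free. *)
Definition arrangement S s :=
  {in S &, injective s} /\ {in S, forall v, (s v < #|S|)%N}.

(** The arrangement may depend on the weights; this freedom makes the convexity argument
    possible. *)
Definition dominated S d := forall w, (forall u v, 0 <= w u v) ->
  exists2 s, arrangement S s &
    wsum S w d <= wsum S w (fun u v => dB #|S| (s u) (s v)).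

Lemma dominated_arr S s d : arrangement S s ->
  {in S &, forall u v, (d u v <= dB #|S| (s u) (s v))%N} -> dominated S d.
Proof.
move=> As le_d w w0; exists s => //; apply: ler_wsum => u v uS vS.
by rewrite ler_wpM2l // ler_nat le_d.
Qed.

(** For given weights, the sum for [d] is at most a weighted mean of those for [d1] and [d2], so it
    does not exceed the larger of the two; which one that is depends on [w]. *)
Lemma dominated_convex a b S d d1 d2 : (0 < a + b)%N ->
  {in S &, forall u v, ((a + b) * d u v <= a * d1 u v + b * d2 u v)%N} ->
  dominated S d1 -> dominated S d2 -> dominated S d.
Proof.
move=> ab0 le_d D1 D2 w w0.
have [s1 A1 le1] := D1 w w0; have [s2 A2 le2] := D2 w w0.
have le12 : (a + b)%:R * wsum S w d <= a%:R * wsum S w d1 + b%:R * wsum S w d2.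
  rewrite /wsum !mulr_sumr -big_split /=; apply: ler_sum => u uS.
  rewrite !mulr_sumr -big_split /=; apply: ler_sum => v vS.
  rewrite !(mulrCA _ (w u v)) -mulrDr ler_wpM2l //.
  by rewrite -!natrM -natrD ler_nat le_d.
have [le_d1|lt_1d] := leP (wsum S w d) (wsum S w d1).
  by exists s1 => //; apply: le_trans le1.
have [le_d2|lt_2d] := leP (wsum S w d) (wsum S w d2).
  by exists s2 => //; apply: le_trans le2.
suff : a%:R * wsum S w d1 + b%:R * wsum S w d2 < (a + b)%:R * wsum S w d.
  by rewrite ltNge le12.
rewrite natrD mulrDl; case: a ab0 {le_d le12} => [|a] ab0.
  by rewrite !mul0r !add0r ltr_pM2l // ltr0n.
by rewrite ltr_leD ?ltr_pM2l ?ltr0n // ler_wpM2l ?ler0n // ltW.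
Qed.

Lemma wsum_setU1 S h w d : h \notin S -> d h h = 0%N ->
  wsum (h |: S) w d =
  wsum S w d + \sum_(v in S) (w h v * (d h v)%:R + w v h * (d v h)%:R).
Proof.
move=> hS dh; rewrite /wsum big_setU1 //= big_setU1 //= dh mulr0 add0r addrC.
rewrite (eq_bigr (fun u => w u h * (d u h)%:R +
   \sum_(v in S) w u v * (d u v)%:R)) => [|u _]; last by rewrite big_setU1.
rewrite big_split /= big_split /= -!addrA addrC -!addrA; congr (_ + _).
Qed.

(** Distances after placing [S] in [B_{m,3}] by [s] and hanging [h] as a pendant vertex from the
    vertex with label [i]. *)
Definition attach (h : V) (m : nat) s (i : nat) (u v : V) : nat :=
  if u == h then (if v == h then 0 else (dB m i (s v)).+1)%N
  else if v == h then (dB m i (s u)).+1 else dB m (s u) (s v).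

(* Moving the weight of [h] onto [p] turns an arrangement of [S] into one of
   [h |: S] with [h] attached to [p]. *)
Lemma dominated_attach S h p d : h \notin S -> p \in S ->
  (forall v, d v v = 0%N) -> (forall v, d v h <= (d v p).+1)%N ->
  (forall v, d h v <= (d p v).+1)%N ->
  dominated S d ->
  (forall s, arrangement S s -> dominated (h |: S) (attach h #|S| s (s p))) ->
  dominated (h |: S) d.
Proof.
move=> hS pS dxx dh1 dh2 domS att w w0.
pose w' u v := w u v + (if u == p then w h v else 0) +
  (if v == p then w u h else 0).
have w'0 u v : 0 <= w' u v.
  by rewrite /w' !addr_ge0 //; case: ifP.
have w'E (d' : V -> V -> nat) : wsum S w' d' = wsum S w d' +
    \sum_(v in S) (w h v * (d' p v)%:R + w v h * (d' v p)%:R).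
  rewrite /wsum big_split /=.
  rewrite (eq_bigr (fun u => \sum_(v in S) w u v * (d' u v)%:R +
     (\sum_(v in S) (if u == p then w h v else 0) * (d' u v)%:R +
      \sum_(v in S) (if v == p then w u h else 0) * (d' u v)%:R))); last first.
    move=> u _; rewrite -!big_split /=; apply: eq_bigr => v _.
    by rewrite /w' !mulrDl addrA.
  rewrite !big_split /=; congr (_ + (_ + _)).
    rewrite (bigD1 p) //= [X in _ + X]big1 ?addr0 => [|u /andP[_ /negPf->]].
      by apply: eq_bigr => v _; rewrite eqxx.
    by apply: big1 => v _; rewrite mul0r.
  apply: eq_bigr => u _; rewrite (bigD1 p) //= eqxx big1 ?addr0 //.
  by move=> v /andP[_ /negPf->]; rewrite mul0r.
have [s As le_s] := domS w' w'0.
have [t At le_t] := att s As w w0; exists t => //; apply: le_trans le_t.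
have neq_h v : v \in S -> (v == h) = false.
  by move=> vS; apply: contraNF hS => /eqP <-.
rewrite !wsum_setU1 ?/attach ?eqxx //.
have -> : wsum S w (attach h #|S| s (s p)) =
    wsum S w (fun u v => dB #|S| (s u) (s v)).
  apply: eq_bigr => u uS; apply: eq_bigr => v vS.
  by rewrite /attach !neq_h.
(* Replacing [h] by [p] shortens each distance from [h] by at most one, so the loss is at most the
   total weight between [h] and [S]. After the rearrangement a pendant [h] recovers exactly this
   amount. *)
have : wsum S w d + \sum_(v in S) (w h v * (d h v)%:R + w v h * (d v h)%:R)
   <= wsum S w' d + \sum_(v in S) (w h v + w v h).
  rewrite w'E -addrA lerD2l -big_split /=; apply: ler_sum => v vS.
  rewrite addrACA lerD //.
    by rewrite -[X in _ + X]mulr1 -mulrDr ler_wpM2l // natr1 ler_nat.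
  by rewrite -[X in _ + X]mulr1 -mulrDr ler_wpM2l // natr1 ler_nat.
move=> h1; apply: le_trans h1 _.
apply: le_trans (lerD le_s (lexx _)) _.
rewrite w'E -addrA lerD2l -big_split /=; apply: ler_sum => v vS.
rewrite neq_h // (dBC _ (s v)) addrACA -[X in (_ + X) + _]mulr1.
by rewrite -[X in _ + (_ + X)]mulr1 -!mulrDr !natr1.
Qed.

End Domination.


(** * A pendant vertex hung on [B_{m,3}] *)

Section Caterpillars.
Variables (R : realType) (V : finType).
Implicit Types (S : {set V}) (s : V -> nat).

Definition relabel (h : V) (k : nat) (g : nat -> nat) s (v : V) : nat :=
  if v == h then k else g (s v).

Lemma arrangement_setU1 S h s k g : h \notin S -> arrangement S s ->
  (k <= #|S|)%N ->
  (forall i j, i < #|S| -> j < #|S| -> g i = g j -> i = j)%N ->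
  (forall i, i < #|S| -> (g i <= #|S|) && (g i != k))%N ->
  arrangement (h |: S) (relabel h k g s).
Proof.
move=> hS [s_inj s_lt] k_le g_inj g_le.
have gs v : v \in S -> ((g (s v) <= #|S|) && (g (s v) != k))%N.
  by move=> /s_lt/g_le.
split=> [u v|v]; rewrite /relabel !inE ?cardsU1 ?hS ?add1n ?ltnS.
  case: (eqVneq u h) => [->|_] /=; case: (eqVneq v h) => [->|_] /= //.
  - by move=> _ /gs/andP[_ /eqP h1] h2; case: h1.
  - by move=> /gs/andP[_ /eqP h1] _ h2; case: h1.
  by move=> uS vS /g_inj e; apply: s_inj => //; apply: e; apply: s_lt.
by have [//|_ /gs/andP[]] := eqVneq v h.
Qed.

Lemma dB_inner n i j :
  (i <= n - 2 -> j <= n - 2 -> dB n i j = (i - j) + (j - i))%N.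
Proof.
by move=> ? ?; rewrite /dB; case: eqP => [->|?]; [|case: ifP => ?]; lia.
Qed.

Lemma dB_last n i : (i < n - 2 -> dB n i n.-1 = n - 2 - i)%N.
Proof.
by move=> ?; rewrite /dB; case: eqP => [->|?]; [|case: ifP => ?]; lia.
Qed.

Lemma dB_leaves n : (2 <= n)%N -> dB n (n - 2) n.-1 = 2.
Proof. by move=> ?; rewrite /dB; case: eqP => ?; [|case: ifP => ?]; lia. Qed.

Lemma dBSS n i j : (2 <= n)%N -> dB n.+1 i.+1 j.+1 = dB n i j.
Proof.
move=> n2; rewrite /dB eqSS; case: eqP => // _.
have -> : (n.+1 - 2 <= i.+1)%N = (n - 2 <= i)%N by lia.
have -> : (n.+1 - 2 <= j.+1)%N = (n - 2 <= j)%N by lia.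
by case: ifP => _; lia.
Qed.

(** A pendant vertex at the free end [0] prolongs the path, and shifting the old labels by one gives
    [B_{m+1,3}] itself. *)
Lemma dominated_attach_first S h s : h \notin S -> (4 <= #|S|)%N ->
  arrangement S s -> dominated R (h |: S) (attach h #|S| s 0).
Proof.
move=> hS S4 As.
apply: (@dominated_arr _ _ _ (relabel h 0 succn s)).
  by apply: arrangement_setU1 => // [i j _ _ []|i] //; lia.
move=> u v; rewrite !inE cardsU1 hS add1n /attach /relabel.
case: (eqVneq u h) => [->|_] /=; case: (eqVneq v h) => [->|_] /= //.
- move=> _ /(proj2 As); set j := s v => lj.
  by rewrite /dB /=; repeat (case: ifPn => ?); lia.
- move=> /(proj2 As) + _; set j := s u => lj.
  by rewrite /dB /=; repeat (case: ifPn => ?); lia.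
by rewrite dBSS //; lia.
Qed.

Lemma dominated_attach_leaf S h s p : h \notin S -> (4 <= #|S|)%N ->
  arrangement S s -> (#|S| - 2 <= p < #|S|)%N ->
  dominated R (h |: S) (attach h #|S| s p).
Proof.
(* The other leaf [q] slides along the path [0 - ... - m-3 - p - h]: attached
   at distance 1 from either end, it gives [B_{m+1,3}]. *)
move=> hS S4 As p_leaf; set m := #|S| in S4 p_leaf *.
have cS : #|h |: S| = m.+1 by rewrite cardsU1 hS.
(* The two leaves are [m - 2] and [m - 1], with sum [2m - 3]. *)
pose q := (2 * m - 3 - p)%N.
(* [g1] reverses the path, with [h] at [0], and thereby hangs [q] from the old vertex [1]; [g2]
   keeps the order and hangs [q] from [p]. *)
pose g1 j := (if j == p then 1 else if j == q then m else m - 1 - j)%N.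
pose g2 j := (if j == p then m - 2 else if j == q then m else j)%N.
(* Among the [m] path vertices counted from [0], the foot [m - 3] of [q] is the mean of [1] and
   [m - 2] with weights [1] and [m - 4]. *)
apply: (@dominated_convex _ _ 1 (m - 4) _ _
   (fun u v => dB m.+1 (relabel h 0 g1 s u) (relabel h 0 g1 s v))
   (fun u v => dB m.+1 (relabel h (m - 1) g2 s u) (relabel h (m - 1) g2 s v))).
- by [].
- move=> u v; rewrite !inE /attach /relabel.
  have key i : (i < m)%N ->
      ((1 + (m - 4)) * (dB m p i).+1 <=
        1 * dB m.+1 0 (g1 i) + (m - 4) * dB m.+1 (m - 1) (g2 i))%N.
    move=> im; rewrite /g1 /g2; have [->|ip] := eqVneq i p.
      by rewrite dBxx !dB_inner; lia.
    have [->|iq] := eqVneq i q.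
      have -> : dB m p q = 2 by rewrite /dB; repeat (case: ifPn => ?); lia.
      have -> : dB m.+1 0 m = (m - 1)%N by rewrite (@dB_last m.+1); lia.
      have -> : dB m.+1 (m - 1) m = 2.
        by have := @dB_leaves m.+1; rewrite subSS /= => ->; lia.
      lia.
    have -> : dB m p i = (m - 2 - i)%N.
      by rewrite /dB; repeat (case: ifPn => ?); lia.
    by rewrite !dB_inner; nia.
  pose ineq i j := ((1 + (m - 4)) * dB m i j <=
        1 * dB m.+1 (g1 i) (g1 j) + (m - 4) * dB m.+1 (g2 i) (g2 j))%N.
  have ineqC i j : ineq i j = ineq j i.
    by rewrite /ineq !(dBC _ i) !(dBC _ (g1 i)) !(dBC _ (g2 i)).
  have g1p : g1 p = 1 by rewrite /g1 eqxx.
  have g2p : g2 p = (m - 2)%N by rewrite /g2 eqxx.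
  have qp : (q == p) = false by apply/eqP; lia.
  have g1q : g1 q = m by rewrite /g1 qp eqxx.
  have g2q : g2 q = m by rewrite /g2 qp eqxx.
  have inner i : (i < m)%N -> i != p -> i != q -> (i < m - 2)%N by lia.
  have g1i i : i != p -> i != q -> g1 i = (m - 1 - i)%N.
    by rewrite /g1 => /negPf-> /negPf->.
  have g2i i : i != p -> i != q -> g2 i = i.
    by rewrite /g2 => /negPf-> /negPf->.
  have leaf_inner r i : (m - 2 <= r < m)%N -> (i < m - 2)%N ->
      dB m r i = (m - 2 - i)%N.
    by move=> ? ?; rewrite /dB; repeat (case: ifPn => ?); lia.
  have last_inner i : (i < m - 1)%N -> dB m.+1 m i = (m - 1 - i)%N.
    by move=> ?; rewrite dBC (@dB_last m.+1); lia.
  have last_leaf : dB m.+1 m (m - 1) = 2.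
    by have := @dB_leaves m.+1; rewrite subSS dBC /= => ->; lia.
  have key2 i j : (i < m)%N -> (j < m)%N -> ineq i j.
    have pi : forall i, (i < m)%N -> i != p -> i != q -> ineq p i.
      move=> k km kp kq; have := inner k km kp kq.
      rewrite /ineq g1p g2p g1i // g2i // leaf_inner // => [k2|];
        by rewrite ?dB_inner; nia.
    have qi : forall i, (i < m)%N -> i != p -> i != q -> ineq q i.
      move=> k km kp kq; have k2 := inner k km kp kq.
      rewrite /ineq g1q g2q g1i // g2i // leaf_inner; [|lia|lia].
      have [->|k0] := posnP k.
        by rewrite !subn0 last_leaf last_inner; nia.
      by rewrite !last_inner; nia.
    have pq : ineq p q.
      rewrite /ineq g1p g2p g1q g2q !(dBC _ _ m) !last_inner; [|lia|lia].
      by rewrite /dB; repeat (case: ifPn => ?); nia.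
    move=> im jm; have [->|ip] := eqVneq i p.
      have [->|jp] := eqVneq j p; first by rewrite /ineq dBxx muln0.
      by have [->|jq] := eqVneq j q; [|apply: pi].
    have [->|iq] := eqVneq i q.
      have [->|jp] := eqVneq j p; first by rewrite ineqC.
      by have [->|jq] := eqVneq j q; [rewrite /ineq dBxx muln0|apply: qi].
    rewrite ineqC; have [->|jp] := eqVneq j p; first exact: pi.
    have [->|jq] := eqVneq j q; first exact: qi.
    have i2 := inner i im ip iq; have j2 := inner j jm jp jq.
    by rewrite /ineq !g1i // !g2i // !dB_inner; lia.
  case: (eqVneq u h) => [->|_] /=; case: (eqVneq v h) => [->|_] /=.
  + by rewrite muln0.
  + by move=> _ /(proj2 As); apply: key.
  + move=> /(proj2 As) ? _; rewrite !(dBC m.+1 _ (_ - 1)) !(dBC m.+1 _ 0).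
    exact: key.
  by move=> /(proj2 As) ? /(proj2 As) ?; apply: key2.
- apply: dominated_arr; last first.
    by move=> u v _ _; rewrite cS.
  apply: arrangement_setU1 => // [i j|i]; rewrite /g1 -/m.
    by do !case: eqP; lia.
  by do !case: eqP; lia.
apply: dominated_arr; last first.
  by move=> u v _ _; rewrite cS.
apply: arrangement_setU1 => // [|i j|i]; rewrite /g2 -/m; first lia.
  by do !case: eqP; lia.
by do !case: eqP; lia.
Qed.

Lemma dominated_attach_any S h s p : h \notin S -> (4 <= #|S|)%N ->
  arrangement S s -> (p < #|S|)%N ->
  dominated R (h |: S) (attach h #|S| s p).
Proof.
move=> hS S4 As pm; have [p_leaf|p_inner] := leqP (#|S| - 2) p.
  by apply: dominated_attach_leaf; rewrite ?p_leaf.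
set m := #|S| in S4 pm p_inner *.
(* The distances from [h] are convex in its point of attachment on the path
   [0 - ... - m-2]. *)
apply: (@dominated_convex _ _ (m - 2 - p) p _ _
  (attach h m s 0) (attach h m s (m - 2))).
- lia.
- move=> u v; rewrite !inE /attach.
  have key j : (j < m)%N -> ((m - 2 - p + p) * (dB m p j).+1 <=
     (m - 2 - p) * (dB m 0 j).+1 + p * (dB m (m - 2) j).+1)%N.
    move=> jm; have [j2|j2] := leqP j (m - 2).
      by rewrite !dB_inner; nia.
    have -> : j = m.-1 by lia.
    rewrite dB_leaves; last lia.
    by rewrite !dB_last; nia.
  case: (eqVneq u h) => [->|_] /=; case: (eqVneq v h) => [->|_] /=.
  + by rewrite !muln0.
  + by move=> _ /(proj2 As); apply: key.
  + by move=> /(proj2 As) ? _; apply: key.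
  by rewrite -mulnDl.
- exact: dominated_attach_first.
by apply: dominated_attach_leaf => //; rewrite -/m; lia.
Qed.

End Caterpillars.


(** * Growing from a star to the whole graph *)

Lemma crossing_edge (G : sgraph) (S : {set G}) (x y : G) :
  connected_graph G -> x \in S -> y \notin S ->
  exists p h, [/\ p \in S, h \notin S & adj p h].
Proof.
move=> cG xS yS.
have [/existsP[p /existsP[h /and3P[]]]|no_edge] :=
    boolP [exists p, exists h, [&& p \in S, h \notin S & adj p h]].
  by exists p, h.
have clS : closed (@adj G) S.
  apply: intro_closed => [|u v auv uS]; first exact/sym_connect_sym/adj_sym.
  apply: contraR no_edge => vS; apply/existsP; exists u.
  apply/existsP; exists v.
  by rewrite uS vS.
by move: yS; rewrite -(closed_connect clS (cG x y)) xS.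
Qed.

Section Branching.
Variables (R : realType) (G : sgraph).
Hypothesis cG : connected_graph G.

(** [B_{4,3}] is the star with centre [1]; further edges of [G] only shorten distances. *)
Lemma dominated_star (c x y z : G) :
  uniq [:: c; x; y; z] -> adj c x -> adj c y -> adj c z ->
  dominated R [set c; x; y; z] (@gdist G).
Proof.
move=> Us cx cy cz.
have card4 : #|[set c; x; y; z]| = 4.
  rewrite -[RHS](card_uniqP Us); apply: eq_card => v.
  by rewrite !inE -!orbA.
have d1 v : v \in [set c; x; y; z] -> (gdist c v <= 1)%N.
  rewrite !inE -!orbA => /or4P[] /eqP->;
    rewrite ?gdistxx //; exact: gdist_adj_le.
move: (Us); rewrite /= !inE !negb_or -!andbA andbT.
case/and5P=> cx' cy' cz' xy' /andP[xz' yz'].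
pose s v :=
  if v == c then 1%N else if v == x then 0%N else if v == y then 2 else 3.
have sc : s c = 1%N by rewrite /s eqxx.
have sx : s x = 0%N by rewrite /s eq_sym (negPf cx') eqxx.
have sy : s y = 2 by rewrite /s eq_sym (negPf cy') eq_sym (negPf xy') eqxx.
have sz : s z = 3.
  by rewrite /s eq_sym (negPf cz') eq_sym (negPf xz') eq_sym (negPf yz').
apply: (@dominated_arr _ _ _ s).
  split=> [u v|u]; rewrite ?card4 !inE -!orbA.
    by move=> /or4P[] /eqP-> /or4P[] /eqP->; rewrite ?sc ?sx ?sy ?sz.
  by move=> /or4P[] /eqP->; rewrite ?sc ?sx ?sy ?sz.
move=> u v uS vS; rewrite card4.
have [<-|uv] := eqVneq u v; first by rewrite gdistxx.
have [uc|uc] := eqVneq u c.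
  rewrite uc; apply: leq_trans (d1 v vS) _; move: vS uv; rewrite uc !inE -!orbA.
  by move=> /or4P[] /eqP->; rewrite ?eqxx // ?sc ?sx ?sy ?sz.
have [vc|vc] := eqVneq v c.
  rewrite vc gdist_sym //; apply: leq_trans (d1 u uS) _.
  move: uS uv; rewrite vc !inE -!orbA.
  by move=> /or4P[] /eqP->; rewrite ?eqxx // ?sc ?sx ?sy ?sz.
have le2 : (gdist u v <= 2)%N.
  apply: leq_trans (gdist_triangle cG c u v) _.
  by rewrite (gdist_sym cG u) -[2%N]/(1 + 1)%N leq_add // d1.
apply: leq_trans le2 _.
move: uS vS uc vc uv; rewrite !inE -!orbA.
by move=> /or4P[] /eqP-> /or4P[] /eqP->; rewrite ?eqxx // ?sc ?sx ?sy ?sz.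
Qed.

(** Induction on the number of missing vertices. Distances are those of the whole graph, so the
    conditions for attaching a new neighbour [q] of [p] are triangle inequalities. *)
Lemma dominated_grow (S : {set G}) : (4 <= #|S|)%N ->
  dominated R S (@gdist G) -> dominated R setT (@gdist G).
Proof.
have [k] := ubnP #|~: S|; elim: k S => // k IHk S /ltnSE cardS S4 domS.
have [C0|[h hS]] := set_0Vmem (~: S).
  by rewrite -[setT](_ : S = _) // -(setCK S) C0 setC0.
have /card_gt0P[x xS] : (0 < #|S|)%N by apply: leq_trans S4.
move: hS; rewrite inE => hS.
have [p [q [pS qS pq]]] := crossing_edge cG xS hS.
apply: (IHk (q |: S)).
- apply: leq_trans cardS; apply: proper_card; apply/properP; split.
    by rewrite setCS subsetUr.
  by exists q; rewrite !inE ?eqxx.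
- by rewrite cardsU1 qS; apply: leq_trans S4 _.
apply: (@dominated_attach _ _ S q p) => //; first exact: gdistxx.
- move=> v; rewrite -addn1; apply: leq_trans (gdist_triangle cG p _ _) _.
  by rewrite leq_add2l gdist_adj_le.
- move=> v; rewrite -add1n; apply: leq_trans (gdist_triangle cG p _ _) _.
  by rewrite leq_add2r gdist_adj_le // adj_sym.
by move=> s As; apply: dominated_attach_any => //; apply: (proj2 As).
Qed.

End Branching.


(** * Distances in [B_{n,3}] *)

Lemma dB_triangle n i j k : (dB n i k <= dB n i j + dB n j k)%N.
Proof. by rewrite /dB; repeat (case: ifPn => ?); lia. Qed.

Lemma dB_eq1 n i j : (3 <= n)%N -> (i <= j < n)%N -> (dB n i j == 1)%N =
  (j == i.+1) && (j <= n - 2)%N || (i == n - 3)%N && (j == n.-1).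
Proof.
by move=> n3 /andP[ij jn]; rewrite /dB; repeat (case: ifPn => ?); lia.
Qed.

Lemma dB_gt0 n i j : (i < n)%N -> (j < n)%N -> (0 < dB n i j)%N = (i != j).
Proof.
by move=> ? ?; rewrite /dB; repeat (case: ifPn => ?); lia.
Qed.

Section B3Labels.
Variable n : nat.
Hypothesis n4 : (4 <= n)%N.

(** One pendant vertex prolongs the path as label [n - 2], the other becomes [n - 1], as in the
    numbering of [dB]. *)
Definition B3_label (x : B3_graph n) : nat :=
  match x with inl i => i | inr k => (n - 2 + k)%N end.

Lemma B3_label_lt x : (B3_label x < n)%N.
Proof. by case: x => i /=; have := ltn_ord i; lia. Qed.

Lemma B3_label_inj : injective B3_label.
Proof.
move=> [i|i] [j|j] //= e; first by congr inl; apply: val_inj.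
- by have := ltn_ord i; lia.
- by have := ltn_ord j; lia.
by congr inr; apply: val_inj => /=; lia.
Qed.

Lemma B3_label_surj k : (k < n)%N -> exists x, B3_label x = k.
Proof.
move=> kn; have [k2|k2] := ltnP k (n - 2).
  by exists (inl (Ordinal k2)).
have k2' : (k - (n - 2) < 2)%N by lia.
by exists (inr (Ordinal k2')) => /=; lia.
Qed.

Lemma B3_adjE x y : adj x y = (dB n (B3_label x) (B3_label y) == 1)%N.
Proof.
have sym u v : (dB n u v == 1)%N = (dB n v u == 1)%N by rewrite dBC.
case: x y => [i|i] [j|j]; rewrite /= ?/path_adj.
- have li := ltn_ord i; have lj := ltn_ord j.
  case: (leqP i j) => ?; [|rewrite sym]; rewrite dB_eq1; lia.
- by have li := ltn_ord i; have lj := ltn_ord j; rewrite dB_eq1; lia.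
- by have li := ltn_ord i; have lj := ltn_ord j; rewrite sym dB_eq1; lia.
have li := ltn_ord i; have lj := ltn_ord j.
by rewrite /dB; repeat (case: ifPn => ?); lia.
Qed.

Lemma dB_pred i j k : (i < n)%N -> (j < n)%N -> dB n i j = k.+1 ->
  exists2 l, (l < n)%N & dB n i l = k /\ dB n l j = 1%N.
Proof.
move=> lt_in lt_jn.
(* The vertex just before [j] on the way from [i]. A leaf has the only neighbour [n - 3]; if
   [j = n - 3] and [i > j], then [i] is itself a leaf next to [j]. *)
exists (if n - 2 <= j then n - 3 else if i < j then j.-1
   else if j == n - 3 then i else j.+1)%N.
  by repeat (case: ifPn => ?); lia.
move: H; case: (leqP (n - 2) j) => ?; [|case: ltnP => ?; [|case: eqP => ?]];
  by rewrite /dB; repeat (case: ifPn => ?); lia.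
Qed.

Lemma B3_walk k x y : dB n (B3_label x) (B3_label y) = k ->
  exists p, [/\ path (@adj (B3_graph n)) x p, last x p = y & size p = k].
Proof.
elim: k y => [|k IHk] y.
  move=> /eqP; rewrite -leqn0 leqNgt dB_gt0 ?B3_label_lt // negbK.
  by move=> /eqP/B3_label_inj ->; exists [::].
move=> /(dB_pred (B3_label_lt _) (B3_label_lt _))[l].
move=> /B3_label_surj[z <-] [xz zy].
have [p [pp lp sp]] := IHk z xz; exists (rcons p y).
by rewrite rcons_path pp lp B3_adjE zy last_rcons size_rcons sp.
Qed.

Lemma B3_connected : connected_graph (B3_graph n).
Proof.
move=> x y; pose d := dB n (B3_label x) (B3_label y).
have [p [pp lp _]] := B3_walk (erefl d).
by apply/connectP; exists p.
Qed.

(** Upper bound by an explicit walk; lower bound because [dB] measured from [x] rises by at most one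
    along each edge. *)
Lemma gdist_B3 (x y : B3_graph n) : gdist x y = dB n (B3_label x) (B3_label y).
Proof.
apply/eqP; rewrite eqn_leq; apply/andP; split.
  have [p [pp lp <-]] := B3_walk (erefl (dB n (B3_label x) (B3_label y))).
  exact: gdist_le.
rewrite -[leqRHS]add0n -(dBxx n (B3_label x)).
apply: (@gdist_lipschitz _ B3_connected
  (fun v => dB n (B3_label x) (B3_label v))).
move=> u v; rewrite B3_adjE => /eqP uv.
by rewrite -addn1 -uv dB_triangle.
Qed.

End B3Labels.

Section BranchingCompare.
Variables (R : realType) (n : nat) (G : sgraph).
Hypotheses (n4 : (4 <= n)%N) (cardG : #|G| = n) (cG : connected_graph G).

(** Every edge of the tree [B_{n,3}] is a bridge. Connectedness of [G] yields an edge across the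
    corresponding cut, and its image can only be that bridge, so adjacency is also reflected. *)
Lemma isomorphic_B3_of_arrangement (s : G -> nat) : arrangement setT s ->
  (forall u v, adj u v -> dB n (s u) (s v) = 1%N) ->
  isomorphic G (B3_graph n).
Proof.
case=> s_inj s_lt s_adj.
have s_ltn v : (s v < n)%N by rewrite -cardG -cardsT s_lt.
have {}s_inj : injective s by move=> u v; apply: s_inj; rewrite inE.
have adj_s u v : adj u v = (dB n (s u) (s v) == 1)%N.
  apply/idP/eqP => [/s_adj//|].
  wlog: u v / (s u <= s v)%N.
    move=> h d1; have [/h->//|/ltnW vu] := leqP (s u) (s v).
    by rewrite adj_sym; apply: h; rewrite // dBC.
  move=> uv /eqP; rewrite dB_eq1 ?uv ?s_ltn //; last exact: ltnW.
  have [v_lt|v_ge] := ltnP (s v) (n - 2) => cases.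
    (* Only one edge of [B_{n,3}] joins the labels up to [s u] to the larger ones. When [v] is a
       leaf, the cut below isolates [v] instead. *)
    have uT : u \in [set x | s x <= s u]%N by rewrite inE.
    have vT : v \notin [set x | s x <= s u]%N by rewrite inE; lia.
    have [p [q []]] := crossing_edge cG uT vT; rewrite !inE => pT qT pq.
    have /eqP := s_adj p q pq; rewrite dB_eq1 ?s_ltn ?andbT; try lia.
    have := s_ltn q => qn e.
    have /s_inj pu : s p = s u by lia.
    have /s_inj qv : s q = s v by lia.
    by rewrite -pu -qv.
  have uT : u \in [set~ v].
    by rewrite !inE; apply/eqP => e; move: cases; rewrite e; lia.
  have vT : v \notin [set~ v] by rewrite !inE negbK.
  have [p [q []]] := crossing_edge cG uT vT; rewrite !inE negbK => pv /eqP-> pq.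
  have pv' : s p != s v by rewrite (inj_eq s_inj).
  suff /s_inj <- : s p = s u by [].
  have := s_ltn p => pn.
  have /eqP := s_adj p v pq; case: (leqP (s p) (s v)) => ?; [|rewrite dBC];
    rewrite dB_eq1; lia.
have ex v : exists x : B3_graph n, B3_label x == s v.
  by have [x <-] := B3_label_surj n4 (s_ltn v); exists x.
pose f v := xchoose (ex v).
have fE v : B3_label (f v) = s v by apply/eqP/(xchooseP (ex v)).
exists f; last by move=> u v; rewrite B3_adjE // !fE adj_s.
apply: inj_card_bij => [u v e|]; first by apply: s_inj; rewrite -!fE e.
by rewrite card_B3_graph ?cardG //; lia.
Qed.

End BranchingCompare.


(** * Comparison of spectral radii *)

Section Comparison.
Variables (R : realType) (alpha : R).
Hypothesis alpha01 : 0 <= alpha < 1.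

Lemma pair_weight_gt0 (V : finType) (x : V -> R) : (forall u, 0 < x u) ->
  forall u v, 0 < pair_weight alpha x u v.
Proof.
move=> x0 u v; case/andP: alpha01 => a0 a1; rewrite /pair_weight.
by rewrite ltr_wpDl ?mulr_gt0 ?subr_gt0 // mulr_ge0 // sqr_ge0.
Qed.

Lemma wsum_setT (V : finType) (w : V -> V -> R) d :
  wsum setT w d = \sum_u \sum_v w u v * (d u v)%:R.
Proof.
apply: eq_big => [u|u _]; first by rewrite inE.
by apply: eq_bigl => v; rewrite inE.
Qed.

(** The vector [x], carried over to [H] by [f], is a test vector in Rayleigh's principle. *)
Lemma form_bij_le_mu (G H : sgraph) (f : G -> H) (x : G -> R) :
  connected_graph H -> bijective f ->
  wsum setT (pair_weight alpha x) (fun u v => gdist (f u) (f v)) <=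
    mu_alpha alpha H * \sum_u x u ^+ 2.
Proof.
move=> cH bij_f; case: (bij_f) => g fK gK.
have := form_le_mu alpha (x \o g) cH.
rewrite (reindex f) /=; last exact: onW_bij.
rewrite [in leRHS](eq_bigr (fun u => x u ^+ 2)) => [|u _]; last by rewrite fK.
apply: le_trans; rewrite le_eqVlt; apply/orP; left; apply/eqP.
rewrite !wsum_setT [RHS](reindex f) /=; last exact: onW_bij.
apply: eq_bigr => u _; rewrite [RHS](reindex f) /=; last exact: onW_bij.
by apply: eq_bigr => v _; rewrite /pair_weight /= !fK.
Qed.

Lemma sum_sqr_gt0 (V : finType) (x : V -> R) : (0 < #|V|)%N ->
  (forall u, 0 < x u) -> 0 < \sum_u x u ^+ 2.
Proof.
case/card_gt0P => v _ x0; rewrite (bigD1 v) //= ltr_pwDl ?exprn_gt0 //.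
by rewrite sumr_ge0 // => u _; rewrite sqr_ge0.
Qed.

Lemma mu_alpha_iso_le (G H : sgraph) : (0 < #|G|)%N ->
  connected_graph G -> connected_graph H ->
  isomorphic G H -> mu_alpha alpha G <= mu_alpha alpha H.
Proof.
move=> G0 cG cH [f bij_f f_adj]; case: (bij_f) => g fK gK.
have [x x0 ex] := perron alpha01 G0 cG.
rewrite -(ler_pM2r (sum_sqr_gt0 G0 x0)) -ex.
apply: le_trans (form_bij_le_mu x cH bij_f).
apply: ler_wsum => u v _ _.
rewrite ler_wpM2l ?(ltW (pair_weight_gt0 x0 _ _)) //.
rewrite ler_nat -{1}(fK u) -{1}(fK v); apply: gdist_homo => // {}u {}v uv.
by rewrite -f_adj !gK.
Qed.

Lemma isomorphic_sym (G H : sgraph) : isomorphic G H -> isomorphic H G.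
Proof.
case=> f [g fK gK] f_adj; exists g; first by exists f.
by move=> x y; rewrite -f_adj !gK.
Qed.

Lemma mu_alpha_iso (G H : sgraph) : (0 < #|G|)%N ->
  connected_graph G -> connected_graph H ->
  isomorphic G H -> mu_alpha alpha G = mu_alpha alpha H.
Proof.
move=> G0 cG cH iGH; apply/le_anti/andP; split; first exact: mu_alpha_iso_le.
apply: mu_alpha_iso_le => //; last exact: isomorphic_sym.
by case: iGH => f bij_f _; rewrite -(bij_eq_card bij_f).
Qed.

Lemma min_pair_gt0 (V : finType) (w : V -> V -> R) :
  (forall u v, 0 < w u v) -> exists2 e, 0 < e & forall u v, e <= w u v.
Proof.
move=> w0; have [V0|/card_gt0P[x _]] := posnP #|V|.
  by exists 1 => // u; have := fintype0 u V0.
have [p _ pmin] := @arg_minP _ _ _ (x, x) predT (fun p => w p.1 p.2) isT.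
by exists (w p.1 p.2) => // u v; apply: (pmin (u, v)).
Qed.

(* Lowering the weight of the edges of [G] by [e] makes the comparison strict
   as soon as an edge is stretched. *)
Lemma dominated_strict (G : sgraph) (w : G -> G -> R) :
  connected_graph G -> (forall u v, 0 < w u v) -> dominated R setT (@gdist G) ->
  exists2 s, arrangement setT s &
    let d u v := dB #|G| (s u) (s v) in
    wsum setT w (@gdist G) < wsum setT w d \/
    wsum setT w (@gdist G) <= wsum setT w d /\
    forall u v, adj u v -> d u v = 1%N.
Proof.
move=> cG w0 domG; have [e e0 e_le] := min_pair_gt0 w0.
pose w' u v := w u v - e * (adj u v)%:R.
have w'0 u v : 0 <= w' u v.
  by rewrite /w' subr_ge0; case: adj; rewrite ?mulr1 ?mulr0 // ltW.
have [s As le_s] := domG w' w'0; exists s => // d; rewrite cardsT -/d in le_s.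
have s_lt v : (s v < #|G|)%N by rewrite -cardsT; apply: (proj2 As).
have d_adj u v : adj u v -> (0 < d u v)%N.
  move=> uv; rewrite /d dB_gt0 //; apply: contraTneq uv.
  by move=> /(proj1 As) ->; rewrite ?inE ?adj_irrefl.
(* An edge has distance 1 in [G], so the comparison under the lowered weights turns into one under
   [w] with the extra gain [e (d u v - 1)] on each edge. *)
pose stretch u v : R := e * (adj u v)%:R * (d u v - 1)%:R.
have st0 u v : 0 <= stretch u v by rewrite /stretch !mulr_ge0 ?(ltW e0).
have le_wd :
    wsum setT w (@gdist G) + \sum_u \sum_v stretch u v <= wsum setT w d.
  rewrite -subr_ge0; move: le_s; rewrite -subr_ge0 => /le_trans-> //.
  rewrite le_eqVlt; apply/orP; left; apply/eqP.
  rewrite opprD addrA !wsum_setT -!sumrB; apply: eq_bigr => u _.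
  rewrite -!sumrB; apply: eq_bigr => v _.
  rewrite /w' /stretch.
  have [uv|_] := boolP (adj u v); last by rewrite /=; ring.
  have /eqP-> : gdist u v == 1%N by rewrite gdist_eq1.
  by rewrite natrB ?d_adj //=; ring.
have [/forallP no_stretch|] :=
    boolP [forall u, forall v, adj u v ==> (d u v == 1%N)].
  right; split.
    apply: le_trans le_wd; rewrite lerDl; apply: sumr_ge0 => u _.
    by apply: sumr_ge0 => v _.
  by move=> u v uv; have /forallP/(_ v) := no_stretch u; rewrite uv => /eqP.
rewrite negb_forall => /existsP[u]; rewrite negb_forall => /existsP[v].
rewrite negb_imply => /andP[uv duv]; left; apply: lt_le_trans le_wd.
rewrite ltrDl (bigD1 u) //= ltr_pwDl ?sumr_ge0 // => [|t _]; last first.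
  by rewrite sumr_ge0.
rewrite (bigD1 v) //= ltr_pwDl ?sumr_ge0 //.
rewrite /stretch uv mulr1 mulr_gt0 // ltr0n subn_gt0 ltn_neqAle eq_sym duv.
exact: d_adj.
Qed.

Section Branching.
Variables (n : nat) (G : sgraph).
Hypotheses (n4 : (4 <= n)%N) (cardG : #|G| = n) (cG : connected_graph G).

(** The Perron vector of [G], moved along the arrangement, is a test vector for [B_{n,3}]. Equality
    of the radii rules out a strict gain, and then every edge of [G] lands on an edge of the
    tree. *)
Lemma mu_alpha_branching : dominated R setT (@gdist G) ->
  mu_alpha alpha G <= mu_alpha alpha (B3_graph n) /\
  (mu_alpha alpha G = mu_alpha alpha (B3_graph n) -> isomorphic G (B3_graph n)).
Proof.
move=> domG; have G0 : (0 < #|G|)%N by rewrite cardG; lia.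
have [x x0 ex] := perron alpha01 G0 cG.
have [s As] := dominated_strict cG (pair_weight_gt0 x0) domG.
rewrite cardG /=; set d := fun u v => _ => h.
have s_lt v : (s v < n)%N by rewrite -cardG -cardsT; apply: (proj2 As).
have exf v : exists y : B3_graph n, B3_label y == s v.
  by have [y <-] := B3_label_surj n4 (s_lt v); exists y.
pose f v := xchoose (exf v).
have fE v : B3_label (f v) = s v by apply/eqP/(xchooseP (exf v)).
have bij_f : bijective f.
  apply: inj_card_bij => [u v e|]; last by rewrite card_B3_graph ?cardG //; lia.
  by apply: (proj1 As); rewrite ?inE // -!fE e.
have le_d : wsum setT (pair_weight alpha x) d <=
    mu_alpha alpha (B3_graph n) * \sum_u x u ^+ 2.
  apply: le_trans (form_bij_le_mu x (B3_connected n4) bij_f).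
  by apply: ler_wsum => u v _ _; rewrite gdist_B3 // !fE.
have sx := sum_sqr_gt0 G0 x0.
case: h => [lt_d|[le_dd d_adj]].
  have lt_mu : mu_alpha alpha G < mu_alpha alpha (B3_graph n).
    by rewrite -(ltr_pM2r sx) -ex; apply: lt_le_trans le_d.
  by split; [exact: ltW|move=> e; rewrite e ltxx in lt_mu].
split; last by move=> _; apply: isomorphic_B3_of_arrangement d_adj.
by rewrite -(ler_pM2r sx) -ex; apply: le_trans le_d.
Qed.

End Branching.

End Comparison.


(** * [B_{n,3}] against the path *)

Lemma path_graph_connected n : connected_graph (path_graph n).
Proof.
case: n => [[]//|n].
have c0 k (kn : (k < n.+1)%N) :
    connect (@adj (path_graph n.+1)) ord0 (Ordinal kn).
  elim: k kn => [|k IHk] kn.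
    by rewrite (_ : Ordinal kn = ord0) //; apply: val_inj.
  apply: connect_trans (IHk (ltnW kn)) (connect1 _).
  by rewrite /= /path_adj /= eqxx.
move=> [i lt_i] [j lt_j]; apply: connect_trans (c0 _ _).
by rewrite (sym_connect_sym (@adj_sym _)).
Qed.

(** The label is 1-Lipschitz, and the two truncated differences add up to [|i - j|]. *)
Lemma gdist_path_ge n (i j : path_graph n) :
  ((i : 'I_n) - (j : 'I_n) + ((j : 'I_n) - (i : 'I_n)) <= gdist i j)%N.
Proof.
have cP := @path_graph_connected n.
have h1 := @gdist_lipschitz _ cP (fun k : 'I_n => nat_of_ord k) i j.
have h2 := @gdist_lipschitz _ cP (fun k : 'I_n => nat_of_ord k) j i.
have adjS (u v : path_graph n) : adj u v -> ((v : 'I_n) <= (u : 'I_n).+1)%N.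
  by rewrite /= /path_adj; lia.
have := h1 adjS; have := h2 adjS; rewrite (gdist_sym cP j i); lia.
Qed.

Section B3Path.
Variables (R : realType) (alpha : R).
Hypothesis alpha01 : 0 <= alpha < 1.

Lemma wsum_relabel_le_mu_path n (w : B3_graph n -> R) (g : nat -> nat) :
  (4 <= n)%N -> (forall u, 0 < w u) ->
  (forall i, i < n -> g i < n)%N ->
  (forall i j, i < n -> j < n -> g i = g j -> i = j)%N ->
  wsum setT (pair_weight alpha w) (fun u v =>
     (g (B3_label u) - g (B3_label v) + (g (B3_label v) - g (B3_label u)))%N) <=
  mu_alpha alpha (path_graph n) * \sum_u w u ^+ 2.
Proof.
move=> n4 w0 g_lt g_inj.
pose f (u : B3_graph n) : path_graph n := Ordinal (g_lt _ (B3_label_lt n4 u)).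
have bij_f : bijective f.
  apply: inj_card_bij => [u v /(congr1 (@nat_of_ord n)) /= e|].
    by apply: B3_label_inj => //; apply: g_inj; rewrite ?B3_label_lt.
  by rewrite card_path_graph card_B3_graph //; lia.
apply: le_trans (form_bij_le_mu alpha w (@path_graph_connected n) bij_f).
apply: ler_wsum => u v _ _.
rewrite ler_wpM2l ?(ltW (pair_weight_gt0 alpha01 w0 _ _)) //.
by rewrite ler_nat; apply: leq_trans (gdist_path_ge _ _).
Qed.

Lemma mu_alpha_B3_lt_path n : (4 <= n)%N ->
  mu_alpha alpha (B3_graph n) < mu_alpha alpha (path_graph n).
Proof.
move=> n4; have B0 : (0 < #|B3_graph n|)%N by rewrite card_B3_graph; lia.
have [x x0 ex] := perron alpha01 B0 (B3_connected n4).
have sx := sum_sqr_gt0 B0 x0.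
(* The pendant vertex [n.-1], attached to [n - 3], slides to the two ends of the
   path [0 - ... - n-2]. *)
pose g1 (j : nat) := (if j == n.-1 then 0 else j.+1)%N.
have := @wsum_relabel_le_mu_path n x id n4 x0 (fun _ => id) (fun _ _ _ _ => id).
have := @wsum_relabel_le_mu_path n x g1 n4 x0.
set P1 := wsum _ _ _ => le1; set P0 := wsum _ _ _ => le0.
have {}le1 : P1 <= mu_alpha alpha (path_graph n) * \sum_u x u ^+ 2.
  apply: le1 => [i|i j]; rewrite /g1.
    by case: eqP; lia.
  by do !case: eqP; lia.
rewrite -(ltr_pM2r sx) -ex.
have n2 : 0 < (n - 2)%:R :> R by rewrite ltr0n; lia.
rewrite -(ltr_pM2l n2).
(* The foot [n - 3] is the mean of the ends [0] and [n - 2] with weights [1] and [n - 3]; convexity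
   gives this inequality after clearing the denominator [n - 2]. *)
suff lt_comb :
    (n - 2)%:R * wsum setT (pair_weight alpha x) (@gdist (B3_graph n)) <
    P1 + (n - 3)%:R * P0.
  apply: lt_le_trans lt_comb _.
  have -> : (n - 2)%N = (1 + (n - 3))%N by lia.
  by rewrite natrD mulrDl mul1r lerD // ler_wpM2l ?ler0n.
pose key i j := ((n - 2) * dB n i j <=
   (g1 i - g1 j + (g1 j - g1 i)) + (n - 3) * (i - j + (j - i)))%N.
have keyC i j : key i j = key j i.
  by rewrite /key dBC [(g1 i - _ + _)%N]addnC [(i - _ + _)%N]addnC.
have key_le i j : (i <= j < n)%N -> key i j.
  move=> /andP[ij jn]; rewrite /key /g1; have [->|jn1] := eqVneq j n.-1.
    have [->|i1] := eqVneq i n.-1; first by rewrite dBxx muln0.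
    have [->|i2] := eqVneq i (n - 2)%N; first by rewrite dB_leaves; lia.
    by rewrite dB_last; nia.
  by rewrite ifF ?dB_inner; [|lia..]; apply/eqP; lia.
have key_lt i j : (i < n)%N -> (j < n)%N -> key i j.
  move=> lt_i lt_j; have [ij|/ltnW ji] := leqP i j; first by rewrite key_le ?ij.
  by rewrite keyC key_le ?ji.
rewrite /P1 /P0 !wsum_setT !mulr_sumr -big_split /=.
pose l := @B3_label n.
have le_uv u v : (n - 2)%:R * (pair_weight alpha x u v * (gdist u v)%:R) <=
   pair_weight alpha x u v *
     (g1 (l u) - g1 (l v) + (g1 (l v) - g1 (l u)))%:R +
   (n - 3)%:R * (pair_weight alpha x u v * (l u - l v + (l v - l u))%:R).
  rewrite !(mulrCA _ (pair_weight _ _ _ _)) -mulrDr.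
  rewrite ler_wpM2l ?(ltW (pair_weight_gt0 alpha01 x0 _ _)) //.
  rewrite -!natrM -natrD ler_nat gdist_B3 //.
  by apply: key_lt; apply: B3_label_lt.
(* Strictness comes from the pair [n - 3], [n - 1]: adjacent in [B_{n,3}], but at distances [n - 2]
   and [2] in the two layouts. *)
have [a ea] := @B3_label_surj n n4 (n - 3) ltac:(lia).
have [b eb] := @B3_label_surj n n4 n.-1 ltac:(lia).
rewrite (bigD1 a) //= [in ltRHS](bigD1 a) //= ltr_leD //; last first.
  apply: ler_sum => u _; rewrite !mulr_sumr -big_split /=.
  by apply: ler_sum => v _.
rewrite !mulr_sumr -big_split /=.
rewrite (bigD1 b) //= [in ltRHS](bigD1 b) //= ltr_leD //; last first.
  by apply: ler_sum => v _.
rewrite !(mulrCA _ (pair_weight _ _ _ _)) -mulrDr.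
rewrite ltr_pM2l ?pair_weight_gt0 // -!natrM -natrD ltr_nat gdist_B3 // ea eb.
rewrite dB_last /g1 ?eqxx; last lia.
by rewrite ifF; [nia|apply/eqP; lia].
Qed.

End B3Path.


(** * Graphs of maximum degree at most 2 *)

Definition max_degree_le2 (G : sgraph) := forall c x y z : G,
  adj c x -> adj c y -> adj c z -> ~~ uniq [:: x; y; z].

(** Take a longest path. If it misses a vertex, some [h] off the path is adjacent to a vertex [p] on
    it: at an end [h] would lengthen the path, and inside it would be a third neighbour of [p]. *)
Lemma hamiltonian_path (G : sgraph) (x0 : G) :
  connected_graph G -> max_degree_le2 G ->
  exists s : seq G, [/\ uniq s, sorted (@adj G) s & forall x, x \in s].
Proof.
move=> cG deg2.
pose P k := [exists t : k.-tuple G, uniq t && sorted (@adj G) t].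
have exP : exists k, P k.
  by exists 1; apply/existsP; exists [tuple x0].
have ubP k : P k -> (k <= #|G|)%N.
  case/existsP => t /andP[/card_uniqP ut _].
  by rewrite -(size_tuple t) -ut max_card.
have [k /existsP[t /andP[ut st]] kmax] := ex_maxnP exP ubP.
have smax s : uniq s -> sorted (@adj G) s -> (size s <= k)%N.
  by move=> us ss; apply: kmax; apply/existsP; exists (in_tuple s); rewrite us.
have k0 : (0 < k)%N by apply: kmax; apply/existsP; exists [tuple x0].
exists t; split=> // x; apply/negPn/negP => xt.
have y0 : nth x0 t 0 \in [set y in t] by rewrite inE mem_nth ?size_tuple.
have xS : x \notin [set y in t] by rewrite inE.
have [p [h []]] := crossing_edge cG y0 xS.
rewrite !inE => pt ht ph; set i := index p t.
have pE : nth x0 t i = p by rewrite nth_index.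
have ik : (i < k)%N by rewrite -[k](size_tuple t) index_mem.
have cons_sorted (s : seq G) :
    sorted (@adj G) s -> adj h (nth x0 s 0) -> sorted (@adj G) (h :: s).
  by case: s => //= a s -> ->.
have rcons_sorted (s : seq G) :
    sorted (@adj G) s -> adj (nth x0 s (size s).-1) h ->
    sorted (@adj G) (rcons s h).
  case: s => //= a s; rewrite rcons_path => ->.
  by rewrite -[size s]/(size (a :: s)).-1 nth_last.
have [i0|i0] := posnP i.
  have : (size (h :: t) <= k)%N; last by rewrite /= size_tuple ltnn.
  apply: smax; first by rewrite /= ht.
  by apply: cons_sorted => //; rewrite adj_sym -i0 pE.
have [iL|iL] := eqVneq i.+1 k.
  have : (size (rcons t h) <= k)%N; last by rewrite size_rcons size_tuple ltnn.
  apply: smax; first by rewrite rcons_uniq ht.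
  by apply: rcons_sorted => //; rewrite (_ : _.-1 = i) ?pE // size_tuple -iL.
have adjS j : (j.+1 < k)%N -> adj (nth x0 t j) (nth x0 t j.+1).
  by move=> jk; apply: (sortedP x0 st); rewrite size_tuple.
have ap : adj p (nth x0 t i.-1).
  by have := adjS i.-1; rewrite (prednK i0) pE adj_sym; apply.
have an : adj p (nth x0 t i.+1).
  by have := adjS i; rewrite pE ltn_neqAle iL; apply.
have := deg2 p _ _ _ ap an ph.
have lt_ip : (i.-1 < k)%N := leq_ltn_trans (leq_pred i) ik.
have lt_iS : (i.+1 < k)%N by rewrite ltn_neqAle iL.
have nh j : (j < k)%N -> (nth x0 t j == h) = false.
  by move=> jk; apply: contraNF ht => /eqP<-; rewrite mem_nth ?size_tuple.
rewrite /= !inE nth_uniq ?size_tuple // !nh // ltn_eqF //.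
by rewrite ltnS leq_pred.
Qed.

(** An inner vertex of the path already has two neighbours there, so any further edge joins the two
    ends. *)
Lemma adj_hamiltonian_path (G : sgraph) (x0 : G) (s : seq G) i j :
  max_degree_le2 G -> uniq s -> sorted (@adj G) s -> (i < j < size s)%N ->
  adj (nth x0 s i) (nth x0 s j) -> j = i.+1 \/ i = 0%N /\ j = (size s).-1.
Proof.
move=> deg2 us ss /andP[ij jn] aij.
have adjS k : (k.+1 < size s)%N -> adj (nth x0 s k) (nth x0 s k.+1).
  exact: (sortedP x0 ss).
have [->|jS] := eqVneq j i.+1; [by left|right].
have neq k l : (k < size s)%N -> (l < size s)%N -> k != l ->
    (nth x0 s k == nth x0 s l) = false.
  by move=> ks ls kl; rewrite nth_uniq ?(negPf kl).
split.
  have [//|i0] := posnP i.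
  have ap : adj (nth x0 s i) (nth x0 s i.-1).
    by have := adjS i.-1; rewrite (prednK i0) adj_sym; apply; lia.
  have an : adj (nth x0 s i) (nth x0 s i.+1) by rewrite adjS //; lia.
  have := deg2 _ _ _ _ ap an aij; rewrite /= !inE !neq //; lia.
have [//|jL] := eqVneq j (size s).-1.
have ap : adj (nth x0 s j) (nth x0 s j.-1).
  by have := adjS j.-1; rewrite prednK 1?adj_sym; [apply; lia|lia].
have an : adj (nth x0 s j) (nth x0 s j.+1) by rewrite adjS //; lia.
rewrite adj_sym in aij.
have := deg2 _ _ _ _ ap an aij; rewrite /= !inE !neq //; lia.
Qed.


(** * Transmissions of the cycle and of [B_{n,3}] *)

(** For [n >= 3] this is the transmission of any vertex of the cycle [C_n], the integer part of
    [n^2 / 4]. *)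
Definition cycle_transmission n := (\sum_(0 <= k < n) minn k (n - k))%N.

(** Induction in steps of two: from [m] to [m + 2] the sum grows by [m + 1]. *)
Lemma cycle_transmission_le n : (4 * cycle_transmission n <= n ^ 2)%N.
Proof.
have step m : cycle_transmission m.+2 = (cycle_transmission m + m.+1)%N.
  rewrite /cycle_transmission big_nat_recl // min0n add0n.
  rewrite (eq_big_nat _ _ (F2 := fun k => minn k (m - k) + 1)%N); last first.
    by move=> k km; lia.
  rewrite big_split /= sum_nat_const_nat big_nat_recr //= subnn minn0 addn0.
  lia.
have [k] := ubnP n; elim: k n => // k IHk [|[|n]] nk.
- by rewrite /cycle_transmission big_geq.
- by rewrite /cycle_transmission big_nat1.
have := IHk n ltac:(lia); rewrite step; nia.
Qed.

(** The total over ordered pairs is [(n^3 - 7n + 18) / 3], written additively to stay within the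
    natural numbers. Passing to [n + 1] adds a vertex at the free end, counted twice, with
    transmission [1 + ... + (n - 1)] plus [n - 1]. *)
Lemma sum_dB n : (3 <= n)%N ->
  (3 * (\sum_(0 <= i < n) \sum_(0 <= j < n) dB n i j) + 7 * n = n ^ 3 + 18)%N.
Proof.
elim: n => // n IHn; rewrite leq_eqVlt => /orP[/eqP<-|].
  by rewrite unlock.
rewrite ltnS => n3; have {IHn} := IHn n3.
have -> : (\sum_(0 <= i < n.+1) \sum_(0 <= j < n.+1) dB n.+1 i j =
   \sum_(0 <= i < n) \sum_(0 <= j < n) dB n i j +
   2 * \sum_(0 <= j < n) dB n.+1 0 j.+1)%N.
  rewrite big_nat_recl // big_nat_recl // dBxx add0n.
  rewrite [X in (_ + X)%N](eq_bigr (fun i =>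
      dB n.+1 0 i.+1 + \sum_(0 <= j < n) dB n i j)%N); last first.
    move=> i _; rewrite big_nat_recl // dBC; congr (_ + _)%N.
    by apply: eq_bigr => j _; rewrite dBSS //; lia.
  rewrite [X in (_ + X)%N]big_split /= addnA addnC; congr (_ + _)%N.
  by rewrite mul2n addnn.
have -> : (\sum_(0 <= j < n) dB n.+1 0 j.+1 =
    \sum_(0 <= j < n.-1) j.+1 + n.-1)%N.
  rewrite -{1}(prednK (_ : 0 < n)%N); last lia.
  rewrite big_nat_recr //= prednK; last lia.
  rewrite (@dB_last n.+1); last lia.
  congr (_ + _)%N; last lia.
  by apply: eq_big_nat => j jn; rewrite dB_inner; lia.
have gauss m : (2 * \sum_(0 <= j < m) j.+1 = m * m.+1)%N.
  elim: m => [|m IHm]; first by rewrite big_geq.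
  by rewrite big_nat_recr //=; nia.
have := gauss n.-1; rewrite prednK; last lia.
by set A := bigop _ _ _; set B := bigop _ _ _; nia.
Qed.


(** * Comparing the cycle with [B_{n,3}] *)

Section MaxDegreeLe2.
Variables (R : realType) (alpha : R).
Hypothesis alpha01 : 0 <= alpha < 1.

(** Bound [x_u x_v] by [(x_u^2 + x_v^2) / 2]; as distances are symmetric, the form is at most the
    sum of [x_u^2] times the transmission of [u]. *)
Lemma mu_alpha_le_transmission (G : sgraph) (m : nat) :
  (0 < #|G|)%N -> connected_graph G ->
  (forall u : G, (transmission u <= m)%N) -> mu_alpha alpha G <= m%:R.
Proof.
move=> G0 cG le_m; case/andP: (alpha01) => a0 a1.
have [x x0 ex] := perron alpha01 G0 cG.
rewrite -(ler_pM2r (sum_sqr_gt0 G0 x0)) -ex.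
pose half u v : R :=
  (alpha * x u ^+ 2 + (1 - alpha) / 2 * x u ^+ 2) * (gdist u v)%:R +
  (1 - alpha) / 2 * x v ^+ 2 * (gdist u v)%:R.
apply: (@le_trans _ _ (\sum_u \sum_v half u v)).
  rewrite wsum_setT; apply: ler_sum => u _; apply: ler_sum => v _.
  rewrite /half -mulrDl ler_wpM2r // /pair_weight -addrA lerD2l -mulrDr.
  have : 0 <= (1 - alpha) / 2 * (x u - x v) ^+ 2.
    by rewrite mulr_ge0 ?sqr_ge0 // divr_ge0 ?subr_ge0 // ltW.
  by nra.
under eq_bigr => u _ do rewrite big_split /=.
rewrite big_split /= [X in _ + X]exchange_big /=.
rewrite -big_split /= mulr_sumr; apply: ler_sum => u _.
rewrite -!mulr_sumr [X in _ + _ * X](eq_bigr (fun v => (gdist u v)%:R)).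
  rewrite -mulrDl -natr_sum -/(transmission u) mulrC.
  have -> : alpha * x u ^+ 2 + (1 - alpha) / 2 * x u ^+ 2 +
      (1 - alpha) / 2 * x u ^+ 2 = x u ^+ 2 by field.
  by apply: ler_wpM2r; rewrite ?sqr_ge0 ?ler_nat.
by move=> v _; rewrite gdist_sym.
Qed.

(** The all-ones vector is the test vector: every pair weight is then [alpha + (1 - alpha) = 1]. *)
Lemma sum_dB_le_mu_alpha n : (4 <= n)%N ->
  (\sum_(0 <= i < n) \sum_(0 <= j < n) dB n i j)%N%:R <=
    mu_alpha alpha (B3_graph n) * n%:R.
Proof.
move=> n4; have := form_le_mu alpha (fun _ => 1) (B3_connected n4).
rewrite [X in _ * X](eq_bigr (fun _ => 1)) => [|u _]; last by rewrite expr1n.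
rewrite sumr_const card_B3_graph; last lia.
apply: le_trans; rewrite le_eqVlt; apply/orP; left; apply/eqP.
pose f (u : B3_graph n) : 'I_n := Ordinal (B3_label_lt n4 u).
have bij_f : bijective f.
  apply: inj_card_bij => [u v /(congr1 (@nat_of_ord n))|].
    exact: B3_label_inj.
  by rewrite card_B3_graph ?card_ord //; lia.
rewrite big_mkord natr_sum wsum_setT (reindex f) /=; last exact: onW_bij.
apply: eq_bigr => u _; rewrite big_mkord natr_sum.
rewrite (reindex f) /=; last exact: onW_bij.
apply: eq_bigr => v _; rewrite gdist_B3 // /pair_weight expr1n !mulr1.
by rewrite addrC subrK mul1r.
Qed.

(** Rotating the cycle sends the labels from [i] on to the front and those below [i] behind them, so
    the base vertex does not matter. *)
Lemma cycle_transmissionE n i : (i < n)%N ->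
  (\sum_(0 <= j < n) minn (i - j + (j - i)) (n - (i - j + (j - i))) =
   cycle_transmission n)%N.
Proof.
move=> lt_in; rewrite /cycle_transmission.
rewrite (@big_cat_nat _ _ _ i) //=; last exact: ltnW.
rewrite [RHS](@big_cat_nat _ _ _ (n - i)) //=; last by rewrite leq_subr.
rewrite addnC; congr (_ + _)%N.
  rewrite -{1}(add0n i) big_addn; apply: eq_big_nat => k kn; lia.
rewrite -(add0n (n - i)%N) big_addn subKn; last exact: ltnW.
by apply: eq_big_nat => k kn; lia.
Qed.

Variables (n : nat) (G : sgraph).
Hypotheses (n4 : (4 <= n)%N) (cardG : #|G| = n) (cG : connected_graph G).

Lemma mu_alpha_max_degree_le2 :
  max_degree_le2 G -> ~ isomorphic G (path_graph n) ->
  mu_alpha alpha G < mu_alpha alpha (B3_graph n).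
Proof.
move=> deg2 nP; have G0 : (0 < #|G|)%N by rewrite cardG; lia.
have /card_gt0P[x0 _] := G0.
have [s [us ss sG]] := hamiltonian_path x0 cG deg2.
have sn : size s = n.
  by rewrite -cardG -(card_uniqP us); apply: eq_card => x; rewrite sG.
pose v := nth x0 s; pose idx x := index x s.
have vK x : v (idx x) = x by rewrite /v nth_index.
have idx_lt x : (idx x < n)%N by rewrite -sn index_mem.
have idx_inj : injective idx by move=> x y e; rewrite -(vK x) -(vK y) e.
have adjS i : (i.+1 < n)%N -> adj (v i) (v i.+1).
  by rewrite -sn; apply: (sortedP x0 ss).
(* Without the closing edge [idx] is an isomorphism onto the path. *)
have [cyc|ncyc] := boolP (adj (v 0%N) (v n.-1)); last first.
  case: nP; exists (fun x => Ordinal (idx_lt x) : path_graph n).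
    apply: inj_card_bij => [x y /(congr1 (@nat_of_ord n))|].
      exact: idx_inj.
    by rewrite card_path_graph cardG.
  have sym_adj x y : (idx x <= idx y)%N ->
      path_adj (Ordinal (idx_lt x)) (Ordinal (idx_lt y)) = adj x y.
    rewrite /path_adj /= leq_eqVlt => /orP[/eqP/idx_inj->|xy].
      by rewrite adj_irrefl; lia.
    have -> : ((idx y).+1 == idx x) = false by apply/eqP; lia.
    rewrite orbF; apply/eqP/idP => [e|axy].
      by rewrite -(vK x) -(vK y) -e adjS // e.
    have := @adj_hamiltonian_path _ x0 s (idx x) (idx y) deg2 us ss.
    rewrite -!/(v _) !vK xy sn idx_lt => /(_ isT axy)[->//|[eqx eqy]].
    by move: axy ncyc; rewrite -(vK x) -(vK y) eqx eqy => ->.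
  move=> x y; have [/sym_adj//|/ltnW yx] := leqP (idx x) (idx y).
  by rewrite adj_sym (adj_sym x); apply: sym_adj.
have dist_le i k : (i + k < n)%N -> (gdist (v i) (v (i + k)) <= k)%N.
  elim: k => [|k IHk] lt_n; first by rewrite addn0 gdistxx.
  apply: leq_trans (gdist_triangle cG (v (i + k)%N) _ _) _.
  rewrite addnS in lt_n *; rewrite -[k.+1]addn1.
  apply: leq_add; first exact/IHk/ltnW.
  exact/gdist_adj_le/adjS.
have dist_le2 i j : (i <= j < n)%N ->
    (gdist (v i) (v j) <= minn (j - i) (n - (j - i)))%N.
  move=> /andP[ij jn]; rewrite leq_min; apply/andP; split.
    by have := @dist_le i (j - i)%N; rewrite subnKC //; apply.
  (* The other way round: from [i] down to [0], over the closing edge, and from [n - 1] down to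
     [j]. *)
  have h0 := dist_le 0%N i; have hn := @dist_le j (n.-1 - j)%N.
  rewrite add0n in h0; rewrite subnKC in hn; last lia.
  apply: leq_trans (gdist_triangle cG (v 0%N) _ _) _.
  apply: leq_trans (leq_add (leqnn _) (gdist_triangle cG (v n.-1) _ _)) _.
  rewrite (gdist_sym cG (v i)) (gdist_sym cG (v n.-1)).
  have := gdist_adj_le cyc; have := h0 ltac:(lia).
  by have := hn ltac:(lia); lia.
have bij_idx : bijective (fun x => Ordinal (idx_lt x)).
  apply: inj_card_bij => [x y /(congr1 (@nat_of_ord n))|].
    exact: idx_inj.
  by rewrite cardG card_ord.
have T_le (u : G) : (transmission u <= cycle_transmission n)%N.
  rewrite -(cycle_transmissionE (idx_lt u)) big_mkord.
  rewrite (reindex (fun x => Ordinal (idx_lt x))) /=; last exact: onW_bij.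
  apply: leq_sum => w _; rewrite -{1}(vK u) -{1}(vK w).
  have iu := idx_lt u; have iw := idx_lt w.
  have [uw|wu] := leqP (idx u) (idx w).
    by apply: leq_trans (dist_le2 _ _ _) _; rewrite ?uw //; lia.
  rewrite gdist_sym //.
  by apply: leq_trans (dist_le2 _ _ _) _; rewrite ?(ltnW wu) //; lia.
apply: le_lt_trans (mu_alpha_le_transmission G0 cG T_le) _.
have n0 : 0 < n%:R :> R by rewrite ltr0n; lia.
rewrite -(ltr_pM2r n0); apply: lt_le_trans (sum_dB_le_mu_alpha n4).
rewrite -natrM ltr_nat.
have := cycle_transmission_le n; have := @sum_dB n ltac:(lia).
set A := bigop _ _ _; set C := cycle_transmission n => eA leC.
(* Here [12 C n <= 3 n^3] and [12 A = 4 n^3 - 28 n + 72]; the difference [n^3 - 28 n + 72] is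
   positive for [n >= 4]. *)
suff : (12 * (C * n) < 12 * A)%N by lia.
have : (3 * (4 * C) * n <= 3 * n ^ 2 * n)%N by nia.
nia.
Qed.

End MaxDegreeLe2.

Theorem theorem6p2 (R : realType) (alpha : R) (n : nat) (G : sgraph) :
  0 <= alpha < 1 ->
  (4 <= n)%N ->
  #|G| = n ->
  connected_graph G ->
  ~ isomorphic G (path_graph n) ->
  mu_alpha alpha G <= mu_alpha alpha (B3_graph n) < mu_alpha alpha (path_graph n)
  /\ (mu_alpha alpha G = mu_alpha alpha (B3_graph n) <->
      isomorphic G (B3_graph n)).
Proof.
move=> alpha01 n4 cardG cG nP.
have G0 : (0 < #|G|)%N by rewrite cardG; lia.
have B_lt_P := mu_alpha_B3_lt_path alpha01 n4.
have iso_mu : isomorphic G (B3_graph n) ->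
    mu_alpha alpha G = mu_alpha alpha (B3_graph n).
  by apply: mu_alpha_iso => //; apply: B3_connected.
pose star := [exists c : G, [exists x, [exists y, [exists z,
  [&& adj c x, adj c y, adj c z & uniq [:: x; y; z]]]]]].
have [|no_star] := boolP star.
  case/existsP => c /existsP[x] /existsP[y] /existsP[z] /and4P[cx cy cz U].
  have Uc : uniq [:: c; x; y; z].
    rewrite cons_uniq U andbT !inE !negb_or.
    by apply/and3P; split; [move: cx|move: cy|move: cz];
      apply: contraTneq => <-; rewrite adj_irrefl.
  have card4 : (4 <= #|[set c; x; y; z]|)%N.
    rewrite -[4%N](card_uniqP Uc) subset_leq_card //.
    by apply/subsetP => u; rewrite !inE -!orbA.
  have domG := dominated_grow cG card4 (dominated_star (R := R) cG Uc cx cy cz).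
  have [le_mu eq_iso] := mu_alpha_branching alpha01 n4 cardG cG domG.
  by rewrite le_mu; split.
have deg2 : max_degree_le2 G.
  move=> c x y z cx cy cz; apply: contra no_star => U.
  apply/existsP; exists c; apply/existsP; exists x; apply/existsP; exists y.
  by apply/existsP; exists z; rewrite cx cy cz.
have lt_mu := mu_alpha_max_degree_le2 alpha01 n4 cardG cG deg2 nP.
rewrite ltW //; split=> //; split=> // e.
by move: lt_mu; rewrite e ltxx.
Qed.
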